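(* Let $\mathbb{G}$ be a Lie $2$-group and $\pi\colon\mathbb{E}\to\mathbb{X}$ a principal $\mathbb{G}$-bundle over a Lie groupoid $\mathbb{X}$. Then $\mathbb{E}$ is a decorated bundle (i.e. is isomorphic, as a principal $\mathbb{G}$-bundle over $\mathbb{X}$, to a decorated $\mathbb{G}$-bundle) if and only if it admits a categorical connection.
   Context: Manifolds are smooth, Hausdorff and second countable. In a Lie groupoid $[X_1\rightrightarrows X_0]$ the source $s$ and target $t$ are surjective submersions; $f_2\circ f_1$ is defined when $t(f_1)=s(f_2)$. A Lie $2$-group $\mathbb{G}=[G_1\rightrightarrows G_0]$ is a (strict) group object in Lie groupoids: $G_0,G_1$ are Lie groups and all groupoid structure maps are homomorphisms. A Lie crossed module $(G,H,\tau,\alpha)$ consists of Lie groups $G,H$, a smooth action $\alpha\colon G\times H\to H$ of $G$ on $H$ by automorphisms ($\alpha_g=\alpha(g,\cdot)$) and a homomorphism $\tau\colon H\to G$ with $\tau(\alpha(g,h))=g\tau(h)g^{-1}$, $\alpha(\tau(h),h')=hh'h^{-1}$. Its Lie $2$-group is $[H\rtimes_\alpha G\rightrightarrows G]$ with $s(h,g)=g$, $t(h,g)=\tau(h)g$, $(h_2,g_2)\circ(h_1,g_1)=(h_2h_1,g_1)$, group product $(h_2,g_2)(h_1,g_1)=(h_2\alpha(g_2,h_1),g_2g_1)$. Every Lie $2$-group arises this way with $G=G_0$, $H=\ker(s\colon G_1\to G_0)$, $\tau=t|_H$, $\alpha(a,\gamma)=1_a\gamma 1_{a^{-1}}$. A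 principal $\mathbb{G}$-bundle over $\mathbb{X}$ is a morphism of Lie groupoids $\pi\colon\mathbb{E}\to\mathbb{X}$ with a morphism of Lie groupoids $\mathbb{E}\times\mathbb{G}\to\mathbb{E}$ whose components are right Lie group actions of $G_i$ on $E_i$, such that $\pi_i\colon E_i\to X_i$ is a principal $G_i$-bundle, $i=0,1$. A morphism of principal $\mathbb{G}$-bundles over $\mathbb{X}$ is a morphism of Lie groupoids $F\colon\mathbb{E}\to\mathbb{E}'$ with each $F_i$ $G_i$-equivariant and $\pi'\circ F=\pi$. A principal $G$-bundle over $\mathbb{X}$, $(\pi\colon E_G\to X_0,\mu,[X_1\rightrightarrows X_0])$, is a principal $G$-bundle $\pi\colon E_G\to X_0$ with a smooth $\mu\colon X_1\times_{s,X_0,\pi}E_G\to E_G$ such that $\mu(1_{\pi(p)},p)=p$; $\pi(\mu(\gamma,p))=t(\gamma)$; $\mu(\gamma_2\circ\gamma_1,p)=\mu(\gamma_2,\mu(\gamma_1,p))$; $\mu(\gamma,p)g=\mu(\gamma,pg)$. The decorated $\mathbb{G}$-bundle associated to it (where $\mathbb{G}=[H\rtimes_\alpha G\rightrightarrows G]$) is $\mathbb{E}^{\mathrm{dec}}=[s^*E_G\times H\rightrightarrows E_G]$, $s^*E_G=X_1\times_{s,X_0,\pi}E_G$, with source $(\gamma,p,h)\mapsto p$, target $(\gamma,p,h)\mapsto\mu(\gamma,p)\tau(h^{-1})$, composition $(\gamma_2,p_2,h_2)\circ(\gamma_1,p_1,h_1)=(\gamma_2\circ\gamma_1,p_1,h_2h_1)$,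 action $(p,g)\mapsto pg$, $(\gamma,p,h)(h',g)=(\gamma,pg,\alpha_{g^{-1}}(h'^{-1}h))$, and projection $p\mapsto\pi(p)$, $(\gamma,p,h)\mapsto\gamma$. A categorical connection on a principal $\mathbb{G}$-bundle $\pi\colon\mathbb{E}\to\mathbb{X}$ is an embedding $\mathcal{C}\colon s^*E_0=X_1\times_{s,X_0,\pi_0}E_0\to E_1$ such that: $s(\mathcal{C}(\gamma,p))=p$; $\pi_1(\mathcal{C}(\gamma,p))=\gamma$; if $s(\gamma_2)=t(\gamma_1)$ and $p_2=t(\mathcal{C}(\gamma_1,p_1))$ then $\mathcal{C}(\gamma_2\circ\gamma_1,p_1)=\mathcal{C}(\gamma_2,p_2)\circ\mathcal{C}(\gamma_1,p_1)$; $\mathcal{C}(1_x,p)=1_p$ for $p\in\pi_0^{-1}(x)$; $\mathcal{C}(\gamma,pg)=\mathcal{C}(\gamma,p)1_g$ for $g\in G_0$. *)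

(* Defs.v *)
(* Fibre products such as [X_1 x_{X_0} E_0] and kernels such as [ker s] are
   needed as manifolds.  Objects are therefore first defined as raw data
   (premanifold, groupoid_data, ...), and the axioms are separate predicates
   (is_manifold, is_lie_groupoid, ...).  A submanifold is then a premanifold by
   definition, and that its charts cover it is a theorem about it. *)
From mathcomp Require Import all_boot all_order all_algebra.
From mathcomp Require Import all_classical all_reals.
From mathcomp Require Import topology normedtype derive.
Set Implicit Arguments.
Unset Strict Implicit.
Unset Printing Implicit Defensive.
Import Order.TTheory GRing.Theory Num.Theory.
Import numFieldNormedType.Exports.
Local Open Scope classical_set_scope.
Local Open Scope ring_scope.

Section Manifolds.
Variable R : realType.

(* To be used on open sets [W] only. *)
Fixpoint Ck_on (m n k : nat) (W : set 'rV[R]_m) (g : 'rV[R]_m -> 'rV[R]_n)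
    : Prop :=
  match k with
  | 0%N => forall x, W x -> {for x, continuous g}
  | k'.+1 => (forall x, W x -> differentiable g x) /\
             (forall v, Ck_on k' W (fun x => 'd g x v))
  end.

Definition Cinfty_on (m n : nat) (W : set 'rV[R]_m)
    (g : 'rV[R]_m -> 'rV[R]_n) : Prop := forall k, Ck_on k W g.

(* A homeomorphism [fwd] from the open set [cdom] onto an open set of R^n, with
   inverse [bwd].  The values of [fwd] outside [cdom], and of [bwd] outside
   [fwd @` cdom], are irrelevant. *)
Record chart (T : topologicalType) (n : nat) := Chart {
  cdom : set T;
  fwd : T -> 'rV[R]_n;
  bwd : 'rV[R]_n -> T;
  cdom_open : open cdom;
  cimg_open : open (fwd @` cdom);
  fwd_cont : forall x, cdom x -> {for x, continuous fwd};
  bwd_cont : forall y, (fwd @` cdom) y -> {for y, continuous bwd};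
  fwdK : forall x, cdom x -> bwd (fwd x) = x
}.

Record premanifold := Premanifold {
  pm_top :> topologicalType;
  mdim : nat;
  atlas : set (chart pm_top mdim)
}.

Definition compatible (T : topologicalType) (n : nat) (c d : chart T n) : Prop :=
  Cinfty_on (fwd c @` (cdom c `&` cdom d)) (fwd d \o bwd c).

Record is_manifold (M : premanifold) : Prop := IsManifold {
  mfd_hausdorff : hausdorff_space M;
  mfd_second_countable : @second_countable M;
  mfd_cover : forall x : M, exists2 c, atlas c & cdom c x;
  mfd_compatible : forall c d : chart M (mdim M),
    atlas c -> atlas d -> compatible c d
}.

Definition maximal_atlas (M : premanifold) : set (chart M (mdim M)) :=
  [set c | forall d, atlas d -> compatible c d /\ compatible d c].

(* [D] is meant to be open. *)
Definition smooth_on (M N : premanifold) (D : set M) (f : M -> N) : Prop :=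
  (forall x, D x -> {for x, continuous f}) /\
  forall (c : chart M (mdim M)) (d : chart N (mdim N)), atlas c -> atlas d ->
    Cinfty_on (fwd c @` (D `&` cdom c `&` f @^-1` cdom d))
              (fwd d \o f \o bwd c).

Definition smooth (M N : premanifold) (f : M -> N) : Prop := smooth_on setT f.

Definition submersion (M N : premanifold) (f : M -> N) : Prop :=
  smooth f /\
  forall (x : M) (c : chart M (mdim M)) (d : chart N (mdim N)),
    atlas c -> atlas d -> cdom c x -> cdom d (f x) ->
    forall w, exists v, 'd (fwd d \o f \o bwd c) (fwd c x) v = w.

Definition immersion (M N : premanifold) (f : M -> N) : Prop :=
  smooth f /\
  forall (x : M) (c : chart M (mdim M)) (d : chart N (mdim N)),
    atlas c -> atlas d -> cdom c x -> cdom d (f x) ->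
    injective ('d (fwd d \o f \o bwd c) (fwd c x)).

Definition embedding (M N : premanifold) (f : M -> N) : Prop :=
  [/\ immersion f, injective f &
      forall U : set M, open U -> exists2 V : set N, open V & U = f @^-1` V].

Definition prod_manifold (M N : premanifold) : premanifold :=
  @Premanifold (M * N)%type (mdim M + mdim N)%N
    [set c | exists c1 c2, [/\ @atlas M c1, @atlas N c2,
       cdom c = cdom c1 `*` cdom c2 &
       forall x, cdom c x -> fwd c x = row_mx (fwd c1 x.1) (fwd c2 x.2)]].

(* [A] with the subspace topology, as an embedded submanifold of [M] of
   codimension [k]: its charts are the restrictions of the slice charts, i.e.
   of the charts of the maximal atlas of [M] in which [A] is cut out by the
   vanishing of the last [k] coordinates. *)
Definition submanifold (M : premanifold) (A : set M) (k : nat) : premanifold :=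
  @Premanifold (set_type A) (mdim M - k)%N
    [set c : chart (set_type A) (mdim M - k) | exists2 d, @maximal_atlas M d &
       [/\ forall x, cdom d x ->
             (A x <-> forall i : 'I_(mdim M),
                        (mdim M - k <= i)%N -> fwd d x 0 i = 0),
           cdom c = [set a | cdom d (val a)] &
           forall (a : set_type A) (i : 'I_(mdim M - k)) (j : 'I_(mdim M)),
             cdom c a -> i = j :> nat ->
             fwd c a 0 i = fwd d (val a) 0 j]].

(* The fibre product over [C]; whenever it is used below one of [f], [g] is a
   submersion, so that it is an embedded submanifold of codimension [dim C]. *)
Definition fibprod (A B C : premanifold) (f : A -> C) (g : B -> C)
    : premanifold :=
  @submanifold (prod_manifold A B) [set x | f x.1 = g x.2] (mdim C).

Definition sub_mk (T : Type) (A : set T) (x : T) (Ax : A x) : set_type A :=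
  exist _ x (mem_set Ax).

Lemma sub_ax (T : Type) (A : set T) (x : set_type A) : A (val x).
Proof. exact: set_mem (valP x). Qed.

End Manifolds.

Section LieGroups.
Variable R : realType.

Record group_data := GroupData {
  gcar :> premanifold R;
  gone : gcar;
  gmul : gcar -> gcar -> gcar;
  ginv : gcar -> gcar
}.

Record is_lie_group (G : group_data) : Prop := IsLieGroup {
  lgr_manifold : is_manifold G;
  lgr_mulA : associative (@gmul G);
  lgr_1mul : left_id (gone G) (@gmul G);
  lgr_mul1 : right_id (gone G) (@gmul G);
  lgr_Vmul : left_inverse (gone G) (@ginv G) (@gmul G);
  lgr_mulV : right_inverse (gone G) (@ginv G) (@gmul G);
  lgr_mul_smooth : smooth (fun x : prod_manifold G G => gmul x.1 x.2);
  lgr_inv_smooth : smooth (@ginv G)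
}.

Definition group_hom (G H : group_data) (f : G -> H) : Prop :=
  {morph f : x y / gmul x y}.

(* A principal right [G]-bundle: smooth action, preserving the fibres, with
   local equivariant trivialisations [pi^-1(U) ~ U x G] over [U]. *)
Record is_principal_bundle (G : group_data) (P B : premanifold R)
    (pi : P -> B) (act : P -> G -> P) : Prop := IsPrincipalBundle {
  pb_group : is_lie_group G;
  pb_total : is_manifold P;
  pb_base : is_manifold B;
  pb_proj_smooth : smooth pi;
  pb_act_smooth : smooth (fun x : prod_manifold P G => act x.1 x.2);
  pb_act1 : forall p, act p (gone G) = p;
  pb_actM : forall p g g', act (act p g) g' = act p (gmul g g');
  pb_act_proj : forall p g, pi (act p g) = pi p;
  pb_trivial : forall b : B, exists (U : set B)
      (triv : P -> prod_manifold B G) (triv' : prod_manifold B G -> P),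
    [/\ open U, U b,
        smooth_on (pi @^-1` U) triv,
        smooth_on [set x : prod_manifold B G | U x.1] triv' &
        [/\ forall p, U (pi p) -> triv' (triv p) = p,
            forall x, U x.1 -> pi (triv' x) = x.1 /\ triv (triv' x) = x,
            forall p, U (pi p) -> (triv p).1 = pi p &
            forall p g, U (pi p) -> (triv (act p g)).2 = gmul (triv p).2 g]]
}.

End LieGroups.

Section Groupoids.
Variable R : realType.

(* [compose] takes the pair (f2, f1), with s(f2) = t(f1), to f2 o f1. *)
Record groupoid_data := GroupoidData {
  obj : premanifold R;
  mor : premanifold R;
  src : mor -> obj;
  tgt : mor -> obj;
  idm : obj -> mor;
  compose : fibprod src tgt -> mor;
  invm : mor -> mor
}.

Definition composable (X : groupoid_data) : premanifold R :=
  fibprod (@src X) (@tgt X).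

Record is_lie_groupoid (X : groupoid_data) : Prop := IsLieGroupoid {
  gd_obj : is_manifold (obj X);
  gd_mor : is_manifold (mor X);
  gd_src_sub : submersion (@src X);
  gd_src_surj : forall x, exists f, @src X f = x;
  gd_tgt_sub : submersion (@tgt X);
  gd_tgt_surj : forall x, exists f, @tgt X f = x;
  gd_idm_smooth : smooth (@idm X);
  gd_compose_smooth : smooth (@compose X);
  gd_invm_smooth : smooth (@invm X);
  gd_src_idm : forall x, src (@idm X x) = x;
  gd_tgt_idm : forall x, tgt (@idm X x) = x;
  gd_src_compose : forall z : composable X, src (compose z) = src (val z).2;
  gd_tgt_compose : forall z : composable X, tgt (compose z) = tgt (val z).1;
  gd_idl : forall (z : composable X) f,
    val z = (idm (tgt f), f) -> compose z = f;
  gd_idr : forall (z : composable X) f,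
    val z = (f, idm (src f)) -> compose z = f;
  gd_assoc : forall (f3 f2 f1 : mor X) (z32 z21 z z' : composable X),
    val z32 = (f3, f2) -> val z21 = (f2, f1) ->
    val z = (compose z32, f1) -> val z' = (f3, compose z21) ->
    compose z = compose z';
  gd_src_inv : forall f : mor X, src (invm f) = tgt f;
  gd_tgt_inv : forall f : mor X, tgt (invm f) = src f;
  gd_invl : forall (z : composable X) f,
    val z = (invm f, f) -> compose z = idm (src f);
  gd_invr : forall (z : composable X) f,
    val z = (f, invm f) -> compose z = idm (tgt f)
}.

Record lie_groupoid := LieGroupoid {
  lgpd_data :> groupoid_data;
  lgpd_ax : is_lie_groupoid lgpd_data
}.

Record is_groupoid_morphism (X Y : groupoid_data)
    (F0 : obj X -> obj Y) (F1 : mor X -> mor Y) : Prop := IsGroupoidMorphism {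
  gm_smooth0 : smooth F0;
  gm_smooth1 : smooth F1;
  gm_src : forall f, src (F1 f) = F0 (src f);
  gm_tgt : forall f, tgt (F1 f) = F0 (tgt f);
  gm_idm : forall x, F1 (idm x) = idm (F0 x);
  gm_compose : forall (z : composable X) (w : composable Y),
    val w = (F1 (val z).1, F1 (val z).2) -> F1 (compose z) = compose w
}.

Section Product.
Variables X Y : groupoid_data.

Definition prod_src (f : prod_manifold (mor X) (mor Y))
    : prod_manifold (obj X) (obj Y) := (src f.1, src f.2).

Definition prod_tgt (f : prod_manifold (mor X) (mor Y))
    : prod_manifold (obj X) (obj Y) := (tgt f.1, tgt f.2).

Lemma prod_composable1 (z : fibprod prod_src prod_tgt) :
  src (val z).1.1 = tgt (val z).2.1.
Proof. by have [] := sub_ax z. Qed.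

Lemma prod_composable2 (z : fibprod prod_src prod_tgt) :
  src (val z).1.2 = tgt (val z).2.2.
Proof. by have [] := sub_ax z. Qed.

Definition prod_groupoid : groupoid_data :=
  @GroupoidData (prod_manifold (obj X) (obj Y)) (prod_manifold (mor X) (mor Y))
    prod_src prod_tgt
    (fun x => (idm x.1, idm x.2))
    (fun z =>
       (compose (sub_mk (x := ((val z).1.1, (val z).2.1)) (prod_composable1 z)),
        compose (sub_mk (x := ((val z).1.2, (val z).2.2)) (prod_composable2 z))))
    (fun f => (invm f.1, invm f.2)).

End Product.

End Groupoids.

Section TwoGroups.
Variable R : realType.

Record two_group_data := TwoGroupData {
  tg0 : group_data R;
  tg1 : group_data R;
  tg_src : tg1 -> tg0;
  tg_tgt : tg1 -> tg0;
  tg_idm : tg0 -> tg1;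
  tg_compose : fibprod tg_src tg_tgt -> tg1;
  tg_invm : tg1 -> tg1
}.

Definition tg_groupoid (G : two_group_data) : groupoid_data R :=
  @GroupoidData R (tg0 G) (tg1 G) (@tg_src G) (@tg_tgt G) (@tg_idm G)
    (@tg_compose G) (@tg_invm G).

Record is_lie_2group (G : two_group_data) : Prop := IsLie2Group {
  tg_group0 : is_lie_group (tg0 G);
  tg_group1 : is_lie_group (tg1 G);
  tg_lie_groupoid : is_lie_groupoid (tg_groupoid G);
  tg_src_hom : group_hom (@tg_src G);
  tg_tgt_hom : group_hom (@tg_tgt G);
  tg_idm_hom : group_hom (@tg_idm G);
  tg_compose_hom : forall x y z : composable (tg_groupoid G),
    val z = (gmul (val x).1 (val y).1, gmul (val x).2 (val y).2) ->
    tg_compose z = gmul (tg_compose x) (tg_compose y);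
  tg_invm_hom : group_hom (@tg_invm G)
}.

Record lie_2group := Lie2Group {
  l2_data :> two_group_data;
  l2_ax : is_lie_2group l2_data
}.

Record crossed_module_data := CrossedModuleData {
  cmG : group_data R;
  cmH : group_data R;
  cm_tau : cmH -> cmG;
  cm_alpha : cmG -> cmH -> cmH
}.

Section OfCrossedModule.
Variable K : crossed_module_data.

Definition semidirect : group_data R :=
  @GroupData R (prod_manifold (cmH K) (cmG K))
    (gone _, gone _)
    (fun x y => (gmul x.1 (cm_alpha x.2 y.1), gmul x.2 y.2))
    (fun x => (cm_alpha (ginv x.2) (ginv x.1), ginv x.2)).

Definition cm_src (x : semidirect) : cmG K := x.2.

Definition cm_tgt (x : semidirect) : cmG K := gmul (cm_tau x.1) x.2.

Definition cm_two_group : two_group_data :=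
  @TwoGroupData (cmG K) semidirect cm_src cm_tgt
    (fun g => (gone _, g))
    (fun z => (gmul (val z).1.1 (val z).2.1, (val z).2.2))
    (fun x => (ginv x.1, cm_tgt x)).

End OfCrossedModule.

Section ToCrossedModule.
Variable G : lie_2group.

Definition ker_set : set (tg1 G) := [set a | tg_src a = gone (tg0 G)].

Lemma hom1 (A B : group_data R) (f : A -> B) :
  is_lie_group A -> is_lie_group B -> group_hom f -> f (gone A) = gone B.
Proof.
move=> hA hB hf; have /(congr1 (gmul (ginv (f (gone A))))) := hf (gone A) (gone A).
by rewrite (lgr_1mul hA) (lgr_mulA hB) (lgr_Vmul hB) (lgr_1mul hB) => <-.
Qed.

Lemma homV (A B : group_data R) (f : A -> B) a :
  is_lie_group A -> is_lie_group B -> group_hom f -> f (ginv a) = ginv (f a).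
Proof.
move=> hA hB hf; have := hf a (ginv a).
rewrite (lgr_mulV hA) (hom1 hA hB hf) => /(congr1 (gmul (ginv (f a)))).
by rewrite (lgr_mulA hB) (lgr_Vmul hB) (lgr_1mul hB) (lgr_mul1 hB).
Qed.

Lemma ker_one : ker_set (gone (tg1 G)).
Proof.
exact: hom1 (tg_group1 (l2_ax G)) (tg_group0 (l2_ax G)) (tg_src_hom (l2_ax G)).
Qed.

Lemma ker_mul (a b : set_type ker_set) : ker_set (gmul (val a) (val b)).
Proof.
rewrite /ker_set /= (tg_src_hom (l2_ax G)) (sub_ax a) (sub_ax b).
exact: lgr_1mul (tg_group0 (l2_ax G)) _.
Qed.

Lemma ker_inv (a : set_type ker_set) : ker_set (ginv (val a)).
Proof.
have [h0 h1] := (tg_group0 (l2_ax G), tg_group1 (l2_ax G)).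
rewrite /ker_set /= (homV _ h1 h0 (tg_src_hom (l2_ax G))) (sub_ax a).
by rewrite -[LHS](lgr_mul1 h0) (lgr_Vmul h0).
Qed.

Lemma ker_conj (g : tg0 G) (a : set_type ker_set) :
  ker_set (gmul (gmul (tg_idm g) (val a)) (tg_idm (ginv g))).
Proof.
have h0 := tg_group0 (l2_ax G).
rewrite /ker_set /= !(tg_src_hom (l2_ax G)) (sub_ax a).
rewrite !(gd_src_idm (tg_lie_groupoid (l2_ax G)) : forall g, tg_src (tg_idm g) = g).
by rewrite (lgr_mul1 h0) (lgr_mulV h0).
Qed.

(* H = ker s; it has codimension dim G_0 since s is a submersion. *)
Definition ker_group : group_data R :=
  @GroupData R (submanifold ker_set (mdim (tg0 G)))
    (sub_mk ker_one)
    (fun a b => sub_mk (ker_mul a b))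
    (fun a => sub_mk (ker_inv a)).

Definition cm_of_2group : crossed_module_data :=
  @CrossedModuleData (tg0 G) ker_group
    (fun a => tg_tgt (val a))
    (fun g a => sub_mk (ker_conj g a)).

(* The isomorphism of Lie 2-groups [H x| G_0 => G_0] ~ [G_1 => G_0] is the
   identity on objects, and (h, g) |-> h 1_g on morphisms. *)
Definition cm_iso0 (g : tg0 (cm_two_group cm_of_2group)) : tg0 G := g.

Definition cm_iso1 (x : tg1 (cm_two_group cm_of_2group)) : tg1 G :=
  gmul (val x.1) (tg_idm x.2).

End ToCrossedModule.

End TwoGroups.

Section Bundles.
Variable R : realType.

Record gbundle_data (G : group_data R) (X : groupoid_data R) := GBundleData {
  gb_tot :> premanifold R;
  gb_proj : gb_tot -> obj X;
  gb_act : gb_tot -> G -> gb_tot;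
  gb_mu : fibprod (@src R X) gb_proj -> gb_tot
}.

Record is_gbundle (G : group_data R) (X : groupoid_data R)
    (P : gbundle_data G X) : Prop := IsGBundle {
  gb_principal : is_principal_bundle (@gb_proj G X P) (@gb_act G X P);
  gb_mu_smooth : smooth (@gb_mu G X P);
  gb_mu1 : forall (z : fibprod (@src R X) (@gb_proj G X P)) p,
    val z = (idm (gb_proj p), p) -> gb_mu z = p;
  gb_mu_proj : forall z : fibprod (@src R X) (@gb_proj G X P),
    gb_proj (gb_mu z) = tgt (val z).1;
  gb_muM : forall (c2 c1 : mor X) (p : P) (c : composable X)
      (z1 z2 z : fibprod (@src R X) (@gb_proj G X P)),
    val c = (c2, c1) -> val z1 = (c1, p) -> val z2 = (c2, gb_mu z1) ->
    val z = (compose c, p) -> gb_mu z = gb_mu z2;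
  gb_mu_act : forall (c : mor X) (p : P) (g : G)
      (z z' : fibprod (@src R X) (@gb_proj G X P)),
    val z = (c, p) -> val z' = (c, gb_act p g) ->
    gb_act (gb_mu z) g = gb_mu z'
}.

Record gbundle (G : group_data R) (X : groupoid_data R) := GBundle {
  gbd :> gbundle_data G X;
  gb_ax : is_gbundle gbd
}.

Record bundle2_data (G : two_group_data R) (X : groupoid_data R) := Bundle2Data {
  b2_tot :> groupoid_data R;
  b2_proj0 : obj b2_tot -> obj X;
  b2_proj1 : mor b2_tot -> mor X;
  b2_act0 : obj b2_tot -> tg0 G -> obj b2_tot;
  b2_act1 : mor b2_tot -> tg1 G -> mor b2_tot
}.

Record is_principal_2bundle (G : two_group_data R) (X : groupoid_data R)
    (E : bundle2_data G X) : Prop := IsPrincipal2Bundle {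
  b2_groupoid : is_lie_groupoid E;
  b2_proj_morphism : is_groupoid_morphism (@b2_proj0 G X E) (@b2_proj1 G X E);
  b2_act_morphism :
    @is_groupoid_morphism R (prod_groupoid E (tg_groupoid G)) E
      (fun x => b2_act0 x.1 x.2) (fun x => b2_act1 x.1 x.2);
  b2_principal0 : is_principal_bundle (@b2_proj0 G X E) (@b2_act0 G X E);
  b2_principal1 : is_principal_bundle (@b2_proj1 G X E) (@b2_act1 G X E)
}.

Record principal_2bundle (G : two_group_data R) (X : groupoid_data R) :=
  Principal2Bundle {
  p2_data :> bundle2_data G X;
  p2_ax : is_principal_2bundle p2_data
}.

Record is_bundle2_morphism (G : two_group_data R) (X : groupoid_data R)
    (E E' : bundle2_data G X) (F0 : obj E -> obj E') (F1 : mor E -> mor E')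
    : Prop := IsBundle2Morphism {
  bm_morphism : is_groupoid_morphism F0 F1;
  bm_equiv0 : forall p g, F0 (b2_act0 p g) = b2_act0 (F0 p) g;
  bm_equiv1 : forall e a, F1 (b2_act1 e a) = b2_act1 (F1 e) a;
  bm_proj0 : forall p, b2_proj0 (F0 p) = b2_proj0 p;
  bm_proj1 : forall e, b2_proj1 (F1 e) = b2_proj1 e
}.

Definition bundle2_isomorphic (G : two_group_data R) (X : groupoid_data R)
    (E E' : bundle2_data G X) : Prop :=
  exists (F0 : obj E -> obj E') (F1 : mor E -> mor E')
         (F0' : obj E' -> obj E) (F1' : mor E' -> mor E),
    [/\ is_bundle2_morphism F0 F1, is_bundle2_morphism F0' F1',
        cancel F0 F0' /\ cancel F0' F0 & cancel F1 F1' /\ cancel F1' F1].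

(* [E] with the structure 2-group changed along psi : G' -> G. *)
Definition restrict_2group (G' G : two_group_data R) (X : groupoid_data R)
    (psi0 : tg0 G' -> tg0 G) (psi1 : tg1 G' -> tg1 G) (E : bundle2_data G X)
    : bundle2_data G' X :=
  @Bundle2Data G' X E (@b2_proj0 G X E) (@b2_proj1 G X E)
    (fun p g => b2_act0 p (psi0 g)) (fun e a => b2_act1 e (psi1 a)).

Section Decorated.
Variables (K : crossed_module_data R) (X : lie_groupoid R) (P : gbundle (cmG K) X).

Let Hax := lgpd_ax X.
Let Pax := gb_ax P.

(* ((gamma, p), h) *)
Definition dec_mor : premanifold R :=
  prod_manifold (fibprod (@src R X) (@gb_proj _ _ P)) (cmH K).

Definition dec_src (e : dec_mor) : P := (val e.1).2.

Definition dec_tgt (e : dec_mor) : P := gb_act (gb_mu e.1) (cm_tau (ginv e.2)).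

Lemma dec_proj_tgt (e : dec_mor) : gb_proj (dec_tgt e) = tgt (val e.1).1.
Proof. by rewrite /dec_tgt (pb_act_proj (gb_principal Pax)) (gb_mu_proj Pax). Qed.

Lemma dec_idm_ax (p : P) : src (idm (gb_proj p)) = gb_proj p.
Proof. exact: gd_src_idm Hax _. Qed.

Lemma dec_composable (z : fibprod dec_src dec_tgt) :
  src (val (val z).1.1).1 = tgt (val (val z).2.1).1.
Proof. by rewrite -dec_proj_tgt -(sub_ax z) (sub_ax (val z).1.1). Qed.

Definition dec_base_compose (z : fibprod dec_src dec_tgt) : mor X :=
  compose (sub_mk (x := ((val (val z).1.1).1, (val (val z).2.1).1))
                  (dec_composable z)).

Lemma dec_compose_ax (z : fibprod dec_src dec_tgt) :
  src (dec_base_compose z) = gb_proj (val (val z).2.1).2.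
Proof.
by rewrite /dec_base_compose (gd_src_compose Hax) /= (sub_ax (val z).2.1).
Qed.

Lemma dec_invm_ax (e : dec_mor) : src (invm (val e.1).1) = gb_proj (dec_tgt e).
Proof. by rewrite dec_proj_tgt (gd_src_inv Hax). Qed.

Lemma dec_act_ax (e : dec_mor) (g : cmG K) :
  src (val e.1).1 = gb_proj (gb_act (val e.1).2 g).
Proof. by rewrite (pb_act_proj (gb_principal Pax)) (sub_ax e.1). Qed.

(* Units and inverses are the ones forced by the composition. *)
Definition dec_groupoid : groupoid_data R :=
  @GroupoidData R P dec_mor dec_src dec_tgt
    (fun p => (sub_mk (x := (idm (gb_proj p), p)) (dec_idm_ax p), gone _))
    (fun z => (sub_mk (x := (dec_base_compose z, (val (val z).2.1).2))
                      (dec_compose_ax z),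
               gmul (val z).1.2 (val z).2.2))
    (fun e => (sub_mk (x := (invm (val e.1).1, dec_tgt e)) (dec_invm_ax e),
               ginv e.2)).

Definition decorated : bundle2_data (cm_two_group K) X :=
  @Bundle2Data (cm_two_group K) X dec_groupoid
    (fun p => gb_proj p)
    (fun e => (val e.1).1)
    (fun p g => gb_act p g)
    (fun e a => (sub_mk (x := ((val e.1).1, gb_act (val e.1).2 a.2))
                        (dec_act_ax e a.2),
                 cm_alpha (ginv a.2) (gmul (ginv a.1) e.2))).

End Decorated.

(* The structure 2-group of a decorated bundle is of the form
   [H x| G_0 => G_0]; a G-bundle is compared with it through the identification
   (h, g) |-> h 1_g of the latter with G. *)
Definition is_decorated (G : lie_2group R) (X : lie_groupoid R)
    (E : bundle2_data G X) : Prop :=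
  exists P : gbundle (tg0 G) X,
    bundle2_isomorphic
      (restrict_2group (@cm_iso0 R G) (@cm_iso1 R G) E)
      (@decorated (cm_of_2group G) X P).

Record is_categorical_connection (G : two_group_data R) (X : groupoid_data R)
    (E : bundle2_data G X)
    (C : fibprod (@src R X) (@b2_proj0 G X E) -> mor E) : Prop :=
  IsCategoricalConnection {
  cc_embedding : embedding C;
  cc_src : forall z, src (C z) = (val z).2;
  cc_proj : forall z, b2_proj1 (C z) = (val z).1;
  cc_compose : forall (c2 c1 : mor X) (p2 p1 : obj E)
      (c : composable X) (e : composable E)
      (z2 z1 z : fibprod (@src R X) (@b2_proj0 G X E)),
    val c = (c2, c1) -> val z1 = (c1, p1) -> val z2 = (c2, p2) ->
    p2 = tgt (C z1) -> val z = (compose c, p1) -> val e = (C z2, C z1) ->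
    C z = compose e;
  cc_idm : forall (z : fibprod (@src R X) (@b2_proj0 G X E)) p,
    val z = (idm (b2_proj0 p), p) -> C z = idm p;
  cc_act : forall (c : mor X) (p : obj E) (g : tg0 G)
      (z z' : fibprod (@src R X) (@b2_proj0 G X E)),
    val z = (c, p) -> val z' = (c, b2_act0 p g) ->
    C z' = b2_act1 (C z) (tg_idm g)
}.

End Bundles.

(* Main.v *)
(* Given a categorical connection C, the object bundle E_0 becomes a principal
   G_0-bundle over X through mu(gamma, p) = t(C(gamma, p)).  Since pi_1 is a
   principal G_1-bundle, every e in E_1 has a unique h(e) in G_1 with
   e h(e) = C(pi_1 e, s e), and comparing sources gives h(e) in ker s; the map
   e |-> ((pi_1 e, s e), h(e)), with inverse ((gamma, p), h) |-> C(gamma, p) h^-1,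
   is the isomorphism with the decorated bundle.  Conversely an isomorphism F
   with a decorated bundle transports the connection (gamma, p) |-> (gamma, p, 1)
   to E; it is an embedding because e |-> (pi_1 e, s e) is a smooth left inverse.
   Smoothness of composites through X_1 x_{X_0} E_0 and ker s requires that the
   slice charts of these submanifolds cover them; both are level sets of a
   submersion near each point, so this follows from the inverse function
   theorem. *)
From HB Require Import structures.
Require Import Defs.
From mathcomp Require Import all_boot all_order all_algebra.
From mathcomp Require Import all_classical all_reals.
From mathcomp Require Import interval_inference topology normedtype landau derive sequences.
From mathcomp Require Import ring lra.
Set Implicit Arguments.
Unset Strict Implicit.
Unset Printing Implicit Defensive.
Import Order.TTheory GRing.Theory Num.Theory.
Import numFieldNormedType.Exports.
Local Open Scope classical_set_scope.
Local Open Scope ring_scope.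
(** * Calculus of C^k maps *)

(** Two obstacles shape the development. A composite of smooth maps is read through a chart at the
    intermediate point, so no map through X_1 x_{X_0} E_0 or [ker s] can be composed before their
    slice charts are known to cover ([charted]); compatibility of these charts ([atlased]) is then
    what makes projections from products smooth. The slice charts have to be produced by hand at
    every point, in a calculus where functions are total and carry arbitrary values off their
    domain; hence the many transfers between functions that agree only near a point. The algebraic
    obstacle is composition. The connection is functorial along its own endpoints: C(gamma_1, s e_1)
    ends not where e_2 starts but at the translate of that point by t(h(e_1)). That e |-> h(e)
    respects composition is therefore not a formal consequence of uniqueness. It needs a correction
    by the unit of t(h(e_1)) and the interchange law of the 2-group. *)

Section Differentials.
Context {R : realType}.

(** Epsilon form of the differential: the error estimate for an inverse map arrives as an inequality
    on increments, not as a little-o equation. *)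
Lemma is_diff_littleo (V W : normedModType R) (f : V -> W) (x : V)
    (L : {linear V -> W}) : continuous L ->
  (forall e, 0 < e -> \forall h \near 0, `|f (h + x) - f x - L h| <= e * `|h|) ->
  is_diff x f L.
Proof.
move=> Lc Lo.
have fL : f \o shift x = cst (f x) + L +o_ 0 id.
  apply/eqaddoP => e e0; have := Lo e e0; apply: filterS => h /=.
  by rewrite !fctE /= opprD addrA.
have dL : 'd f x = L :> (V -> W) by exact: diff_unique.
by split=> //; apply/diff_locallyP; rewrite dL.
Qed.

Lemma differentiable_littleo (V W : normedModType R) (f : V -> W) (x : V) e :
  differentiable f x -> 0 < e ->
  \forall h \near 0, `|f (h + x) - f x - 'd f x h| <= e * `|h|.
Proof.
move=> /diff_locally /eqaddoP df e0; have := df e e0; apply: filterS => h /=.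
by rewrite !fctE /= opprD addrA.
Qed.

Lemma near_eq_is_diff (V W : normedModType R) (f g : V -> W) (x : V) :
  (\forall y \near x, f y = g y) -> differentiable f x -> is_diff x g ('d f x).
Proof.
move=> fg df; apply: is_diff_littleo => [|e e0]; first exact: diff_continuous.
have := fg; rewrite (near_shift 0 x) => fg0.
apply: filterS2 fg0 (differentiable_littleo df e0) => h /=; rewrite subr0 => -> .
by rewrite (nbhs_singleton fg).
Qed.

Lemma continuous_coords (T : topologicalType) m n (f : T -> 'M[R]_(m, n)) (x : T) :
  (forall i j, {for x, continuous (fun y => f y i j)}) -> {for x, continuous f}.
Proof.
move=> fc; apply/cvgrPdist_le => /= e e0.
have : \forall t \near x, forall ij : 'I_m * 'I_n, `|f x ij.1 ij.2 - f t ij.1 ij.2| <= e.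
  by apply: filter_forall => -[i j]; have /cvgrPdist_le := fc i j; apply.
apply: filterS => t ft; rewrite /Num.Def.normr/= mx_normrE (bigmax_le _ (ltW e0))//=.
by move=> ij _; rewrite !mxE.
Qed.

Lemma continuous_near_eq (T U : topologicalType) (f g : T -> U) (x : T) :
  (\forall y \near x, f y = g y) -> {for x, continuous f} -> {for x, continuous g}.
Proof.
move=> fg fc; rewrite /prop_for /continuous_at -(nbhs_singleton fg).
by apply: cvg_trans fc; apply: near_eq_cvg.
Qed.

Lemma continuous_pair (T U V : topologicalType) (f : T -> U) (g : T -> V) (x : T) :
  {for x, continuous f} -> {for x, continuous g} ->
  {for x, continuous (fun y => (f y, g y))}.
Proof. by move=> fc gc; exact: (cvg_pair fc gc). Qed.

Lemma mulmx_continuous m n p :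
  continuous (fun q : 'M[R]_(m, n) * 'M[R]_(n, p) => q.1 *m q.2).
Proof.
move=> q; apply: continuous_coords => i j.
have -> : (fun y : 'M[R]_(m, n) * 'M[R]_(n, p) => (y.1 *m y.2) i j) =
          fun y => \sum_k y.1 i k * y.2 k j.
  by apply/funext => y; rewrite mxE.
rewrite /prop_for /continuous_at.
apply: cvg_big => [|k _]; first exact: add_continuous.
apply: cvgM.
- apply: (@continuous_comp _ _ _ fst (fun M : 'M[R]_(m, n) => M i k)); first exact: cvg_fst.
  exact: coord_continuous.
- apply: (@continuous_comp _ _ _ snd (fun M : 'M[R]_(n, p) => M k j)); first exact: cvg_snd.
  exact: coord_continuous.
Qed.

(** A linear map of row vectors is multiplication by its matrix [lin1_mx L], so this is continuity
    of the matrix product in one argument. *)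
Lemma rV_linear_continuous m n (L : {linear 'rV[R]_m -> 'rV[R]_n}) : continuous L.
Proof.
have -> : (L : 'rV_m -> 'rV_n) = (fun q => q.1 *m q.2) \o (fun x => (x, lin1_mx L)).
  by apply/funext => x /=; rewrite mul_rV_lin1.
move=> x; apply: continuous_comp; last exact: mulmx_continuous.
apply: continuous_pair; last exact: cst_continuous.
by move=> A; rewrite /nbhs/=.
Qed.

End Differentials.

Section CkCalculus.
Context {R : realType}.

(** Openness turns agreement on [W] into agreement near each of its points, which forces equal
    differentials at every order. *)
Lemma Ck_on_ext m n k (W : set 'rV[R]_m) (f g : 'rV[R]_m -> 'rV[R]_n) :
  open W -> (forall x, W x -> f x = g x) -> Ck_on k W f -> Ck_on k W g.
Proof.
move=> Wo; have nearfg f' g' x : (forall y, W y -> f' y = g' y :> 'rV[R]_n) -> W x ->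
    \forall y \near x, f' y = g' y.
  by move=> fg Wx; apply: filterS fg _; apply: open_nbhs_nbhs.
elim: k f g => [|k IH] f g fg /=.
  by move=> fc x Wx; apply: continuous_near_eq (fc x Wx); exact: nearfg.
case=> df Cf; have isd x : W x -> is_diff x g ('d f x).
  by move=> Wx; apply: near_eq_is_diff (df x Wx); exact: nearfg.
split=> [x Wx|v]; first by have [] := isd x Wx.
apply: (IH (fun x => 'd f x v) (fun x => 'd g x v)) (Cf v) => x Wx.
have [_ E] := isd x Wx.
exact: (congr1 (@^~ v) (esym E)).
Qed.

Lemma Ck_on_sub m n k (W W' : set 'rV[R]_m) (f : 'rV[R]_m -> 'rV[R]_n) :
  W' `<=` W -> Ck_on k W f -> Ck_on k W' f.
Proof.
move=> W'W; elim: k f => [|k IH] f /=; first by move=> fc x /W'W /fc.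
by case=> df Cf; split=> [x /W'W /df //|v]; apply: IH.
Qed.

(** Each level of [Ck_on] is a condition at single points on a totally defined function, so it can
    be checked on singletons although these need not be open. This is what makes smoothness
    local. *)
Lemma Ck_on_point m n k (W : set 'rV[R]_m) (f : 'rV[R]_m -> 'rV[R]_n) :
  (forall x, W x -> Ck_on k [set x] f) -> Ck_on k W f.
Proof.
elim: k f => [|k IH] f /= Cf; first by move=> x Wx; apply: Cf Wx x erefl.
split=> [x Wx|v]; first by have [df _] := Cf x Wx; exact: df.
by apply: IH => x /Cf[].
Qed.

Lemma Ck_on_pred m n k (W : set 'rV[R]_m) (f : 'rV[R]_m -> 'rV[R]_n) :
  Ck_on k.+1 W f -> Ck_on k W f.
Proof.
elim: k f => [|k IH] f; first by case=> df _ x /df; exact: differentiable_continuous.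
by case=> df Cf; split=> // v; apply: IH.
Qed.

Lemma Ck_on_continuous m n k (W : set 'rV[R]_m) (f : 'rV[R]_m -> 'rV[R]_n) :
  Ck_on k W f -> forall x, W x -> {for x, continuous f}.
Proof. by elim: k => [//|k IH] /Ck_on_pred. Qed.

Lemma Ck_on_cst m n k (W : set 'rV[R]_m) (a : 'rV[R]_n) : Ck_on k W (fun=> a).
Proof.
elim: k a => [|k IH] a /=; first by move=> x _; exact: cst_continuous.
split=> [x _|v]; first exact: differentiable_cst.
have -> : (fun x : 'rV[R]_m => 'd (fun=> a) x v) = fun=> 0.
  by apply/funext => x; rewrite (diff_cst a x).
exact: IH.
Qed.

Lemma Ck_on_linear m n k (W : set 'rV[R]_m) (L : {linear 'rV[R]_m -> 'rV[R]_n}) :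
  Ck_on k W L.
Proof.
have Lc := @rV_linear_continuous R m n L.
case: k => [|k] /=; first by move=> x _; exact: Lc.
split=> [x _|v]; first exact: linear_differentiable.
have -> : (fun x : 'rV[R]_m => 'd L x v) = fun=> L v.
  by apply/funext => x; rewrite (diff_lin _ Lc).
exact: Ck_on_cst.
Qed.

Lemma Ck_on_add m n k (W : set 'rV[R]_m) (f g : 'rV[R]_m -> 'rV[R]_n) :
  open W -> Ck_on k W f -> Ck_on k W g -> Ck_on k W (fun x => f x + g x).
Proof.
move=> Wo; elim: k f g => [|k IH] f g /=.
  by move=> fc gc x Wx; exact: (continuousD (fc x Wx) (gc x Wx)).
move=> [df Cf] [dg Cg]; split=> [x Wx|v].
  by apply: differentiableD; [exact: df|exact: dg].
apply: Ck_on_ext (IH _ _ (Cf v) (Cg v)) => // x Wx.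
exact: (congr1 (@^~ v) (esym (diffD (df x Wx) (dg x Wx)))).
Qed.

(** Scalar functions are encoded as 1 x 1 matrices, because [Ck_on] concerns row vectors only. The
    Leibniz rule is the differential of the bilinear map [mulmx]; each of its two terms pairs a
    derivative with an undifferentiated factor, lowered one order by [Ck_on_pred]. *)
Lemma Ck_on_mulmx m p k (W : set 'rV[R]_m) (f : 'rV[R]_m -> 'rV[R]_1)
    (g : 'rV[R]_m -> 'rV[R]_p) :
  open W -> Ck_on k W f -> Ck_on k W g -> Ck_on k W (fun x => f x *m g x).
Proof.
move=> Wo; elim: k f g => [|k IH] f g /=.
  move=> fc gc x Wx.
  apply: (@continuous_comp _ _ _ (fun x => (f x, g x)) (fun q => q.1 *m q.2)).
    by apply: continuous_pair; [exact: fc|exact: gc].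
  exact: mulmx_continuous.
move=> [df Cf] [dg Cg].
have isd x : W x ->
    is_diff x (fun x => f x *m g x) (fun v => f x *m 'd g x v + 'd f x v *m g x).
  move=> Wx; have dfg := is_diff_pair (differentiableP (df x Wx)) (differentiableP (dg x Wx)).
  have dm : is_diff (f x, g x) (fun q : 'rV[R]_1 * 'rV[R]_p => q.1 *m q.2)
      (fun q => f x *m q.2 + q.1 *m g x).
    split; first exact/differentiable_bilin/mulmx_continuous.
    by rewrite diff_bilin//; exact: mulmx_continuous.
  by have := @is_diff_comp _ _ _ _ _ _ _ _ _ dfg dm.
split=> [x Wx|v]; first by have [] := isd x Wx.
have Cfg := IH _ _ (Ck_on_pred (conj df Cf)) (Cg v).
have Cgf := IH _ _ (Cf v) (Ck_on_pred (conj dg Cg)).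
apply: (Ck_on_ext Wo _ (Ck_on_add Wo Cfg Cgf)) => x Wx.
have [_ E] := isd x Wx; exact: (congr1 (@^~ v) (esym E)).
Qed.

Lemma Ck_on_sum (I : finType) m n k (W : set 'rV[R]_m) (f : I -> 'rV[R]_m -> 'rV[R]_n) :
  open W -> (forall i, Ck_on k W (f i)) -> Ck_on k W (fun x => \sum_i f i x).
Proof.
move=> Wo Cf; elim: (index_enum I) => [|i s IH].
  apply: Ck_on_ext (Ck_on_cst k W 0) => // x _; by rewrite big_nil.
apply: Ck_on_ext (Ck_on_add Wo (Cf i) IH) => // x _; by rewrite big_cons.
Qed.

(** The differential 'd f (g x) ('d g x v) depends on [x] both through the base point and through
    the vector. Expanding the vector in the standard basis separates the two: each term is a
    coordinate of 'd g x v times 'd f (g x) at a fixed basis vector, and the induction hypothesis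
    applies to both factors. *)
Lemma Ck_on_comp m n p k (V : set 'rV[R]_n) (W : set 'rV[R]_m)
    (f : 'rV[R]_n -> 'rV[R]_p) (g : 'rV[R]_m -> 'rV[R]_n) :
  open W -> (forall x, W x -> V (g x)) -> Ck_on k V f -> Ck_on k W g ->
  Ck_on k W (f \o g).
Proof.
move=> Wo WV; elim: k p V f g WV => [|k IH] p V f g WV /=.
  move=> fc gc x Wx; apply: continuous_comp; first exact: gc.
  exact/fc/WV.
move=> [df Cf] [dg Cg]; split=> [x Wx|v].
  by apply: differentiable_comp; [exact: dg|exact/df/WV].
have Cterm i : Ck_on k W (fun x => ('d g x v *m delta_mx i 0 : 'rV_1) *m
                                   'd f (g x) (delta_mx 0 i)).
  apply: Ck_on_mulmx => //.
    pose L : {linear 'rV[R]_n -> 'rV[R]_1} := mulmxr (delta_mx i 0).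
    exact: (IH _ setT L (fun x => 'd g x v) (fun _ _ => I) (Ck_on_linear k setT L) (Cg v)).
  exact: (IH _ V (fun y => 'd f y (delta_mx 0 i)) g WV (Cf _) (Ck_on_pred (conj dg Cg))).
apply: (Ck_on_ext Wo _ (Ck_on_sum Wo Cterm)) => x Wx.
have E := diff_comp (dg x Wx) (df _ (WV x Wx)).
rewrite [RHS](congr1 (@^~ v) E) /=.
move: ('d g x v) => u; move: ('d f (g x)) => h.
rewrite [in RHS](row_sum_delta u) linear_sum; apply: eq_bigr => i _.
rewrite linearZ /= -colE; have -> : col i u = (u 0 i)%:M.
  by apply/rowP => j; rewrite !mxE !ord1 eqxx.
by rewrite mul_scalar_mx.
Qed.

Lemma Ck_on_lin_comp m n p k (W : set 'rV[R]_m) (L : {linear 'rV[R]_n -> 'rV[R]_p})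
    (g : 'rV[R]_m -> 'rV[R]_n) :
  open W -> Ck_on k W g -> Ck_on k W (L \o g).
Proof.
by move=> Wo; apply: (@Ck_on_comp _ _ _ _ setT) => //; exact: Ck_on_linear.
Qed.

Lemma Ck_on_coords m n k (W : set 'rV[R]_m) (f : 'rV[R]_m -> 'rV[R]_n) :
  open W -> (forall j, Ck_on k W (fun x => (f x 0 j)%:M : 'rV_1)) -> Ck_on k W f.
Proof.
move=> Wo Cf.
have Cterm j : Ck_on k W (fun x => ((f x 0 j)%:M : 'rV_1) *m (delta_mx 0 j : 'rV_n)).
  by apply: Ck_on_mulmx => //; exact: Ck_on_cst.
apply: (Ck_on_ext Wo _ (Ck_on_sum Wo Cterm)) => x Wx.
by rewrite [RHS]row_sum_delta; apply: eq_bigr => i _; rewrite mul_scalar_mx.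
Qed.

Lemma Ck_on_coord m n k (W : set 'rV[R]_m) (f : 'rV[R]_m -> 'rV[R]_n) j :
  open W -> Ck_on k W f -> Ck_on k W (fun x => (f x 0 j)%:M : 'rV_1).
Proof.
move=> Wo Cf; pose L : {linear 'rV[R]_n -> 'rV[R]_1} := mulmxr (delta_mx j 0).
apply: (Ck_on_ext Wo _ (Ck_on_lin_comp L Wo Cf)) => x _ /=.
by apply/rowP => i; rewrite -colE !mxE !ord1 eqxx.
Qed.

(** Inversion [iota] satisfies d iota(u) v = - iota(u)^2 v, an expression in [iota] itself, so its
    regularity climbs by induction. The trace reads off the entry of a 1 x 1 matrix as a linear
    map. *)
Lemma Ck_on_inv m k (W : set 'rV[R]_m) (a : 'rV[R]_m -> R) :
  open W -> (forall x, W x -> a x != 0) ->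
  Ck_on k W (fun x => (a x)%:M : 'rV_1) ->
  Ck_on k W (fun x => (a x)^-1%:M : 'rV_1).
Proof.
move=> Wo a0 Ca; pose U := [set u : 'rV[R]_1 | \tr u != 0].
have trc : continuous (mxtrace : 'rV[R]_1 -> R).
  have -> : (mxtrace : 'rV[R]_1 -> R) = fun u => u 0 0.
    by apply/funext => u; rewrite /mxtrace big_ord1.
  exact: coord_continuous.
have Uo : open U.
  have := @open_comp _ _ mxtrace [set r : R | r != 0] (fun x _ => trc x); apply.
  exact: open_neq.
pose iota (u : 'rV[R]_1) : 'rV[R]_1 := (\tr u)^-1 *: 1%:M.
have isd u : U u -> is_diff u iota (fun v => - (iota u *m iota u *m v)).
  move=> Uu.
  have dtr : differentiable (mxtrace : 'rV[R]_1 -> R) u by exact: linear_differentiable.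
  have dV := differentiableV dtr Uu.
  split; first exact: differentiableZl.
  rewrite (diffZl _ dV); apply/funext => v.
  rewrite (congr1 (@^~ v) (diffV dtr Uu)) /= (congr1 (@^~ v) (diff_lin u trc)).
  have iM w : iota u *m w = (\tr u)^-1 *: w by rewrite /iota -scalemxAl mul1mx.
  have vE : v = (\tr v) *: 1%:M by rewrite scalemx1 {1}[v]mx11_scalar /mxtrace big_ord1.
  by rewrite -mulmxA !iM [in RHS]vE !scalerA -scaleNr /= -expr2 exprVn -mulNr.
suff Ci : Ck_on k U iota.
  have WU x : W x -> U (a x)%:M by move=> Wx; rewrite /U /= mxtrace_scalar mulr1n a0.
  apply: (Ck_on_ext Wo _ (Ck_on_comp Wo WU Ci Ca)) => x Wx.
  by rewrite /= /iota mxtrace_scalar mulr1n scalemx1.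
elim: k {Ca} => [|k IH] /=.
  move=> u Uu; apply: differentiable_continuous; exact: (@ex_diff _ _ _ _ _ _ _ (isd u Uu)).
split=> [u Uu|v]; first exact: (@ex_diff _ _ _ _ _ _ _ (isd u Uu)).
pose L : {linear 'rV[R]_1 -> 'rV[R]_1} := -%R.
have C1 := Ck_on_mulmx Uo (Ck_on_mulmx Uo IH IH) (Ck_on_cst k U v).
apply: (Ck_on_ext Uo _ (Ck_on_lin_comp L Uo C1)) => u Uu.
have [_ E] := isd u Uu; exact: (congr1 (@^~ v) (esym E)).
Qed.

End CkCalculus.

(** * The inverse function theorem *)

(* Makes matrices a [completeNormedModType], for [banach_fixed_point]. *)
HB.instance Definition _ (R : realType) m n := Complete.on 'M[R]_(m, n).

Section SmoothMatrixInverse.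
Context {R : realType}.
Variables (m k : nat) (W : set 'rV[R]_m).
Hypothesis Wo : open W.

Definition Ck_scalar (a : 'rV[R]_m -> R) : Prop :=
  Ck_on k W (fun x => (a x)%:M : 'rV_1).

Lemma Ck_scalar_cst c : Ck_scalar (fun=> c).
Proof. exact: Ck_on_cst. Qed.

Lemma Ck_scalarM a b : Ck_scalar a -> Ck_scalar b -> Ck_scalar (fun x => a x * b x).
Proof.
move=> Ca Cb; apply: (Ck_on_ext Wo _ (Ck_on_mulmx Wo Ca Cb)) => x _.
by rewrite -scalar_mxM.
Qed.

Lemma Ck_scalar_sum (I : finType) (a : I -> 'rV[R]_m -> R) :
  (forall i, Ck_scalar (a i)) -> Ck_scalar (fun x => \sum_i a i x).
Proof.
move=> Ca; apply: (Ck_on_ext Wo _ (Ck_on_sum Wo Ca)) => x _.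
by rewrite raddf_sum.
Qed.

Lemma Ck_scalar_prod (I : finType) (a : I -> 'rV[R]_m -> R) :
  (forall i, Ck_scalar (a i)) -> Ck_scalar (fun x => \prod_i a i x).
Proof.
move=> Ca; elim: (index_enum I) => [|i s IH].
  by have := Ck_scalar_cst 1; congr Ck_scalar; apply/funext => x; rewrite big_nil.
have := Ck_scalarM (Ca i) IH.
by congr Ck_scalar; apply/funext => x; rewrite big_cons.
Qed.

Lemma Ck_scalar_det n (A : 'rV[R]_m -> 'M[R]_n) :
  (forall i j, Ck_scalar (fun x => A x i j)) -> Ck_scalar (fun x => \det (A x)).
Proof.
move=> CA; apply: Ck_scalar_sum => s; apply: Ck_scalarM; first exact: Ck_scalar_cst.
exact: Ck_scalar_prod.
Qed.

(** Cramer's rule: the entries of the inverse are cofactors divided by the determinant, hence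
    polynomials in the entries of [A x] times an inverse. The fixed row [v] is the direction in
    which an inverse map will be differentiated. *)
Lemma Ck_on_mul_invmx n (A : 'rV[R]_m -> 'M[R]_n) (v : 'rV[R]_n) :
  (forall i j, Ck_scalar (fun x => A x i j)) -> (forall x, W x -> A x \in unitmx) ->
  Ck_on k W (fun x => v *m invmx (A x)).
Proof.
move=> CA uA; apply: Ck_on_coords => // j.
have CI : Ck_scalar (fun x => (\det (A x))^-1).
  apply: Ck_on_inv => //; last exact: Ck_scalar_det.
  by move=> x /uA; rewrite unitmxE unitfE.
have : Ck_scalar (fun x => \sum_i v 0 i * ((\det (A x))^-1 * \adj (A x) i j)).
  apply: Ck_scalar_sum => i; apply: Ck_scalarM; first exact: Ck_scalar_cst.
  apply: Ck_scalarM => //.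
  have -> : (fun x => \adj (A x) i j) = fun x => cofactor (A x) j i.
    by apply/funext => x; rewrite mxE.
  apply: Ck_scalarM; first exact: Ck_scalar_cst.
  apply: Ck_scalar_det => i' j'.
  by have := CA (lift j i') (lift i j'); congr Ck_scalar; apply/funext => x; rewrite !mxE.
apply: Ck_on_ext => // x Wx; rewrite mxE; congr (_%:M).
by apply: eq_bigr => i _; rewrite /invmx uA// [in RHS]mxE.
Qed.

End SmoothMatrixInverse.

Section InverseFunction.
Context {R : realType}.

Lemma open_preimageI (T U : topologicalType) (f : T -> U) (A : set T) (B : set U) :
  open A -> (forall x, A x -> {for x, continuous f}) -> open B ->
  open (A `&` f @^-1` B).
Proof.
move=> Ao fc Bo; rewrite openE => x [Ax Bx]; apply: filterI.
  exact: open_nbhs_nbhs.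
exact/(fc x Ax)/open_nbhs_nbhs.
Qed.

(** The mean value theorem is applied to each coordinate along the segment from [y] to [x], which
    stays in the ball by convexity. Since the norm is the maximum of the coordinates, nothing is
    lost in the constant. *)
Lemma lipschitz_on_ball n p (h : 'rV[R]_n -> 'rV[R]_p) (x0 : 'rV[R]_n) (r c : R) :
  (forall x, `|x - x0| < r -> differentiable h x) ->
  (forall x v, `|x - x0| < r -> `|'d h x v| <= c * `|v|) ->
  forall x y, `|x - x0| < r -> `|y - x0| < r -> `|h x - h y| <= c * `|x - y|.
Proof.
move=> dh hc x y xr yr; pose gam (t : R) := y + t *: (x - y).
have gamr (t : R) : 0 <= t -> t <= 1 -> `|gam t - x0| < r.
  move=> t0 t1; have -> : gam t - x0 = t *: (x - x0) + (1 - t) *: (y - x0).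
    by apply/rowP => i; rewrite /gam !mxE; ring.
  apply: le_lt_trans (ler_normD _ _) _.
  rewrite !normrZ (ger0_norm t0) (ger0_norm (_ : 0 <= 1 - t)) ?subr_ge0//.
  have -> : r = t * r + (1 - t) * r by rewrite -mulrDl addrCA subrr addr0 mul1r.
  (* Strictness comes from the [x] term when [t] is positive, and from the [y] term when [t]
     vanishes. *)
  have [->|tn0] := eqVneq t 0.
    by rewrite !mul0r !add0r subr0 !mul1r.
  apply: ltr_leD.
    by rewrite ltr_pM2l// lt_def tn0.
  by rewrite ler_wpM2l ?subr_ge0// ltW.
have dgam (t : R) : is_diff t gam ( *:%R ^~ (x - y)).
  have := is_diffD (is_diff_cst y t) (is_diff_scalel t (x - y)).
  by rewrite add0r.
have isd (t : R) : 0 <= t -> t <= 1 -> is_diff t (h \o gam) (fun s => 'd h (gam t) (s *: (x - y))).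
  by move=> t0 t1; have := is_diff_comp (dgam t) (differentiableP (dh _ (gamr t t0 t1))).
have isD (t : R) : 0 <= t -> t <= 1 -> is_derive t 1 (h \o gam) ('d h (gam t) (x - y)).
  move=> t0 t1; have [dhg E] := isd t t0 t1; split; first exact: diff_derivable.
  by rewrite deriveE// E scale1r.
have isDj j (t : R) : 0 <= t -> t <= 1 ->
    is_derive t 1 (fun t => h (gam t) 0 j) ('d h (gam t) (x - y) 0 j).
  move=> t0 t1; have [D E] := isD t t0 t1; split.
    by move/derivable_mxP: D; apply.
  by rewrite -E (derive_mx D) mxE.
have hge0 : 0 <= c * `|x - y| by apply: le_trans (hc x (x - y) xr).
rewrite [leLHS]/Num.Def.normr/= mx_normrE bigmax_le//= => -[i j] _ /=.
rewrite ord1 !mxE; pose phi (t : R) := h (gam t) 0 j.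
have -> : h x 0 j - h y 0 j = phi 1 - phi 0.
  by rewrite /phi /gam scale1r scale0r addr0 subrKC.
have [||t t01 ->] := @MVT_segment R phi (fun t => 'd h (gam t) (x - y) 0 j) 0 1 ler01.
- by move=> t; rewrite in_itv/= => /andP[t0 t1]; apply: isDj; exact: ltW.
- apply: derivable_within_continuous => t; rewrite in_itv/= => /andP[t0 t1].
  by have [] := isDj j t t0 t1.
rewrite subr0 mulr1; move: t01; rewrite in_itv/= => /andP[t0 t1].
apply: le_trans (hc (gam t) (x - y) (gamr t t0 t1)).
rewrite [leRHS]/Num.Def.normr/= mx_normrE.
exact: (le_bigmax _ (fun ij => `|'d h (gam t) (x - y) ij.1 ij.2|) (0, j)).
Qed.

(** The map x |-> y + h x moves [x0] by less than r / 2, and [h] varies by at most r / 2 on the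
    closed ball. So the closed ball is sent into the open one, and the fixed point given by
    completeness lies in the open ball. *)
Lemma contraction_surj n (h : 'rV[R]_n -> 'rV[R]_n) (x0 y : 'rV[R]_n) (r : R) :
  0 < r ->
  (forall x x', `|x - x0| <= r -> `|x' - x0| <= r -> `|h x - h x'| <= 2^-1 * `|x - x'|) ->
  `|y + h x0 - x0| < r / 2 -> exists2 x, `|x - x0| < r & y + h x = x.
Proof.
move=> r0 hl yr; pose T x := y + h x; pose B := [set x : 'rV[R]_n | `|x - x0| <= r].
have Tx0 x : B x -> `|T x - x0| < r.
  move=> Bx; have -> : T x - x0 = (h x - h x0) + (y + h x0 - x0).
    by apply/rowP => i; rewrite /T !mxE; ring.
  apply: le_lt_trans (ler_normD _ _) _.
  have := hl x x0 Bx; rewrite subrr normr0 => /(_ (ltW r0)) hx.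
  move: Bx; rewrite /B /= => Bx.
  apply: le_lt_trans (lerD hx (lexx _)) _; lra.
have TB : set_fun B B T by move=> x /Tx0 /ltW.
pose TM := @isFun.Build _ _ B B T TB.
pose TF : {fun B >-> B} := HB.pack T TM.
have [] := @banach_fixed_point R 'rV[R]_n B TF.
- have h0 : 0 <= 2^-1 :> R by rewrite invr_ge0.
  exists (NngNum h0); split; first by rewrite /=; lra.
  by move=> [x x'] /= [Bx Bx']; rewrite /T opprD addrACA subrr add0r; exact: hl.
- have -> : B = closed_ball x0 r.
    by rewrite closed_ballE// /closed_ball_; apply/seteqP; split => x /=; rewrite distrC.
  exact: closed_ball_closed.
- by exists x0; rewrite /B /= subrr normr0 ltW.
move=> x Bx xE; exists x; last exact: esym.
by rewrite [x in x - _]xE; apply: Tx0.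
Qed.

(* [id - f] is a contraction, so [y + (id - f)] has a fixed point for [y] near
   [f x0], and this fixed point is a preimage of [y]. *)
Lemma near_identity_inverse n (f : 'rV[R]_n -> 'rV[R]_n) (x0 : 'rV[R]_n) (r : R) :
  0 < r ->
  (forall x, `|x - x0| < r -> differentiable f x) ->
  (forall x v, `|x - x0| < r -> `|v - 'd f x v| <= 2^-1 * `|v|) ->
  exists U g, [/\ open U, U x0, U `<=` [set x | `|x - x0| < r], open (f @` U) &
    (forall x, U x -> g (f x) = x) /\
    (forall x x', U x -> U x' -> `|x - x'| <= 2 * `|f x - f x'|)].
Proof.
move=> r0 df dfl; pose h x := x - f x.
have isdh x : `|x - x0| < r -> is_diff x h (fun v => v - 'd f x v).
  by move=> xr; have := is_diffB (is_diff_id x) (differentiableP (df x xr)).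
have hl : forall x x', `|x - x0| < r -> `|x' - x0| < r -> `|h x - h x'| <= 2^-1 * `|x - x'|.
  apply: lipschitz_on_ball => [x xr|x v xr].
    by have [] := isdh x xr.
  have [_ E] := isdh x xr.
  by rewrite (congr1 (@^~ v) E); exact: dfl.
have fl x x' : `|x - x0| < r -> `|x' - x0| < r -> `|x - x'| <= 2 * `|f x - f x'|.
  move=> xr xr'; have := hl x x' xr xr'.
  have := ler_normD (f x - f x') (h x - h x').
  have -> : f x - f x' + (h x - h x') = x - x'.
    by apply/rowP => i; rewrite /h !mxE; ring.
  lra.
(* The contraction estimate holds on the open ball of radius [r], whereas [contraction_surj] wants a
   closed ball: it is applied with radius r / 2, which leaves a tolerance of half of that for
   [y]. *)
pose V := [set y | `|f x0 - y| < r / 2 / 2].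
have Vo : open V.
  have -> : V = ball (f x0) (r / 2 / 2) by rewrite -ball_normE.
  exact: ball_open.
pose B := [set x | `|x - x0| < r].
have Bo : open B.
  have -> : B = ball x0 r.
    by rewrite -ball_normE; apply/seteqP; split => x /=; rewrite distrC.
  exact: ball_open.
pose U := B `&` f @^-1` V.
have UVE : f @` U = V.
  apply/seteqP; split => [_ [x [_ Vx] <-//]|y Vy].
  have [|||x xr xE] := @contraction_surj n h x0 y (r / 2).
  - lra.
  - by move=> x x' xr xr'; apply: hl; lra.
  - have -> : y + h x0 - x0 = y - f x0 by apply/rowP => i; rewrite /h !mxE; ring.
    by rewrite distrC.
  have fx : f x = y.
    by apply/rowP => i; move/rowP/(_ i) : xE; rewrite /h !mxE; lra.
  by exists x => //; split; [rewrite /B /=; lra|rewrite /= fx].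
(* The inverse picks a preimage in [U], with default [x0] off the image; the estimate [fl] makes the
   preimage unique. *)
exists U, (fun y => xget x0 [set x | U x /\ f x = y]); split.
- apply: (open_preimageI Bo _ Vo) => x Bx.
  exact: (differentiable_continuous (df x Bx)).
- by split; rewrite /B /V /= subrr normr0 ?divr_gt0.
- by move=> x [].
- by rewrite UVE.
split=> [x Ux|x x' [Bx _] [Bx' _]]; last exact: fl.
have [[Bx' _] fx'] := @xgetPex _ x0 [set x' | U x' /\ f x' = f x] (ex_intro _ x (conj Ux erefl)).
apply/eqP; rewrite -subr_eq0 -normr_le0.
case: Ux => Bx _; apply: le_trans (fl _ _ Bx' Bx) _.
by rewrite fx' subrr normr0 mulr0.
Qed.

(** With k = f x' - f x, the error x' - x - A^-1 k equals - A^-1 (k - 'd f x (x' - x)). The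
    Lipschitz bound on the inverse turns an error that is small relative to x' - x into one that is
    small relative to [k]. *)
Lemma inverse_is_diff n (f g : 'rV[R]_n -> 'rV[R]_n) (U : set 'rV[R]_n) (x : 'rV[R]_n) :
  open (f @` U) -> (forall x, U x -> g (f x) = x) ->
  (forall x x', U x -> U x' -> `|x - x'| <= 2 * `|f x - f x'|) ->
  U x -> differentiable f x -> 'J f x \in unitmx ->
  is_diff (f x) g (mulmxr (invmx ('J f x))).
Proof.
move=> fUo gK gl Ux df uJ; set A := 'J f x.
have Lc := @rV_linear_continuous R n n (mulmxr (invmx A)).
apply: is_diff_littleo => // e e0.
have [c c0 Lb] := linear_lipschitz Lc.
(* Here [c] bounds the inverse matrix and 2 is the Lipschitz constant of the inverse map, so the
   three factors multiply to [e]. Likewise |k| < d / 2 below forces |x' - x| < d. *)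
have e'0 : 0 < e / (c * 2) by rewrite divr_gt0 ?mulr_gt0.
have /nbhs_normP[d /= d0 Hd] := differentiable_littleo df e'0.
have nearU : \forall k \near 0, (f @` U) (k + f x).
  have : \forall y \near f x, (f @` U) y by apply: open_nbhs_nbhs; split=> //; exists x.
  by rewrite (near_shift 0 (f x)); apply: filterS => k /=; rewrite subr0.
have nearB : \forall k \near (0 : 'rV[R]_n), `|k| < d / 2.
  apply/nbhs_normP; exists (d / 2); first by rewrite /= divr_gt0.
  by move=> k /=; rewrite sub0r normrN.
apply: filterS2 nearU nearB => k [x' Ux' fx'] kd.
rewrite -fx' !gK//; have kE : k = f x' - f x by rewrite fx' addrK.
have := gl x' x Ux' Ux; rewrite -kE => xk.
have xd : `|0 - (x' - x)| < d by rewrite sub0r normrN; lra.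
have := Hd _ xd; rewrite /= subrK -kE => Hk.
rewrite -normrN.
have -> : - (x' - x - mulmxr (invmx A) k) = mulmxr (invmx A) (k - 'd f x (x' - x)).
  have -> : 'd f x (x' - x) = (x' - x) *m A by rewrite /A /jacobian mul_rV_lin1.
  by rewrite /= mulmxBl mulmxK// opprB.
apply: le_trans (Lb _) _.
apply: (@le_trans _ _ (c * (e / (c * 2) * (2 * `|k|)))).
  by rewrite ler_wpM2l ?(ltW c0)//; apply: le_trans Hk _; rewrite ler_wpM2l ?(ltW e'0).
by rewrite le_eqVlt; apply/orP; left; apply/eqP; field; rewrite gt_eqF.
Qed.

(** Bootstrapping: the differential of [g] at [y] is the inverse of the Jacobian of [f] at [g y], so
    [g] of class C^k has a C^k differential and is of class C^(k+1). *)
Lemma inverse_smooth n (f g : 'rV[R]_n -> 'rV[R]_n) (U : set 'rV[R]_n) :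
  open U -> open (f @` U) -> (forall x, U x -> g (f x) = x) ->
  (forall x x', U x -> U x' -> `|x - x'| <= 2 * `|f x - f x'|) ->
  Cinfty_on U f -> (forall x, U x -> 'J f x \in unitmx) -> Cinfty_on (f @` U) g.
Proof.
move=> Uo fUo gK gl Cf uJ.
have isd y : (f @` U) y -> is_diff y g (mulmxr (invmx ('J f (g y)))).
  move=> [x Ux <-]; rewrite gK//; apply: (inverse_is_diff fUo gK gl Ux _ (uJ x Ux)).
  by have [df _] := Cf 1; exact: df.
have gU y : (f @` U) y -> U (g y) by move=> [x Ux <-]; rewrite gK.
elim=> [|k IH].
  by move=> y /isd[dg _]; exact: differentiable_continuous.
split=> [y /isd[]//|v].
have CJ i j : Ck_scalar k (f @` U) (fun y => 'J f (g y) i j).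
  have [_ /(_ (delta_mx 0 i)) Cdf] := Cf k.+1.
  apply: (Ck_on_ext fUo _ (Ck_on_coord j fUo (Ck_on_comp fUo gU Cdf IH))) => y _.
  by rewrite /= /jacobian mxE.
have uJg y : (f @` U) y -> 'J f (g y) \in unitmx by move=> /gU; exact: uJ.
apply: (Ck_on_ext fUo _ (Ck_on_mul_invmx fUo v CJ uJg)) => y /isd[_ E].
exact: (congr1 (@^~ v) (esym E)).
Qed.

Lemma inj_lin1_unitmx n (L : {linear 'rV[R]_n -> 'rV[R]_n}) :
  injective L -> lin1_mx L \in unitmx.
Proof.
move=> Linj; rewrite -row_free_unit; apply: inj_row_free => v.
by rewrite mul_rV_lin1 => Lv0; apply: Linj; rewrite Lv0 linear0.
Qed.

(** Composing [f] with the inverse [L] of its differential at [x0] gives a map [F] whose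
    differential at [x0] is the identity, which reduces the claim to [near_identity_inverse]; the
    inverse of [f] is then that of [F] after [L]. *)
Theorem inverse_function n (f : 'rV[R]_n -> 'rV[R]_n) (W : set 'rV[R]_n) (x0 : 'rV[R]_n) :
  open W -> W x0 -> Cinfty_on W f -> injective ('d f x0) ->
  exists U g, [/\ open U, U x0, U `<=` W, open (f @` U) &
    (forall x, U x -> g (f x) = x) /\ Cinfty_on (f @` U) g].
Proof.
move=> Wo Wx0 Cf /inj_lin1_unitmx; rewrite -/(jacobian f x0) => uA.
set A := 'J f x0 in uA; pose L : {linear 'rV[R]_n -> 'rV[R]_n} := mulmxr (invmx A).
have Lc : continuous L by exact: rV_linear_continuous.
pose F x := L (f x).
have CF : Cinfty_on W F by move=> k; exact: Ck_on_lin_comp.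
have df x : W x -> differentiable f x by have [df _] := Cf 1; exact: df.
have dF x v : W x -> 'd F x v = L ('d f x v).
  move=> Wx; have E := diff_comp (df x Wx) (linear_differentiable (f x) Lc).
  apply: etrans (congr1 (@^~ v) E) _.
  exact: (congr1 (@^~ ('d f x v)) (diff_lin (f x) Lc)).
pose h v x := 'd F x v.
have Ch v : Cinfty_on W (h v) by move=> k; have [_] := CF k.+1; exact.
have h0 v : h v x0 = v.
  by rewrite /h dF// /L /= -[X in X *m _]mul_rV_lin1 mulmxK.
(* The differential is compared with the identity on the [n] basis vectors; [n] errors below [c] add
   up to at most 1/2. Dividing by n + 1 also covers n = 0. *)
pose c := 2^-1 / n.+1%:R : R.
have c0 : 0 < c by rewrite divr_gt0// invr_gt0.
have : \forall x \near x0, W x /\ forall i : 'I_n, `|h (delta_mx 0 i) x0 - h (delta_mx 0 i) x| < c.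
  near=> x; split; first by near: x; exact: open_nbhs_nbhs.
  near: x; apply: filter_forall => i.
  have hc := Ck_on_continuous (Ch (delta_mx 0 i) 0) Wx0.
  by move/cvgrPdist_lt: hc; apply.
move=> /nbhs_normP[r /= r0 Hr].
have BW x : `|x - x0| < r -> W x.
  by move=> xr; have [] := Hr x ltac:(by rewrite /= distrC).
have Hb x v : `|x - x0| < r -> `|v - 'd F x v| <= 2^-1 * `|v|.
  move=> xr; have [Wx hx] := Hr x ltac:(by rewrite /= distrC).
  have -> : v - 'd F x v = \sum_i v 0 i *: (h (delta_mx 0 i) x0 - h (delta_mx 0 i) x).
    rewrite [in LHS](row_sum_delta v) linear_sum -sumrB; apply: eq_bigr => i _.
    by rewrite linearZ /= scalerBr h0.
  apply: le_trans (ler_norm_sum _ _ _) _.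
  apply: (@le_trans _ _ (\sum_(i < n) `|v| * c)).
    apply: ler_sum => i _; rewrite normrZ; apply: ler_pM => //; last exact/ltW/hx.
    rewrite [leRHS]/Num.Def.normr/= mx_normrE.
    exact: (le_bigmax _ (fun ij => `|v ij.1 ij.2|) (0, i)).
  rewrite sumr_const card_ord -[leLHS]mulr_natr -mulrA [leRHS]mulrC ler_wpM2l// /c.
  rewrite -mulrA ler_piMr ?invr_ge0//.
  by rewrite ler_pdivrMl// mulr1 ler_nat.
have dFr x : `|x - x0| < r -> differentiable F x.
  by move=> /BW; have [dF' _] := CF 1; exact: dF'.
have [U [g [Uo Ux0 Ur FUo [gK gl]]]] := near_identity_inverse r0 dFr Hb.
have UW : U `<=` W by move=> x /Ur; exact: BW.
(* A vector killed by the differential satisfies |v| <= |v| / 2, so the bound [Hb] gives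
   invertibility on all of [U]. *)
have uJ x : U x -> 'J F x \in unitmx.
  move=> /Ur xr; rewrite -row_free_unit; apply: inj_row_free => v.
  rewrite mul_rV_lin1 => v0; have := Hb x v xr; rewrite v0 subr0 => vle.
  by apply/eqP; rewrite -normr_le0; lra.
have Cg := inverse_smooth Uo FUo gK gl (fun k => Ck_on_sub UW (CF k)) uJ.
have fUE : f @` U = setT `&` L @^-1` (F @` U).
  apply/seteqP; split => [_ [x Ux <-]|y [_ [x Ux]]]; first by split=> //; exists x.
  by move=> /(congr1 (mulmxr A)); rewrite /F /L /= !mulmxKV// => <-; exists x.
have fUo : open (f @` U).
  by rewrite fUE; exact: (open_preimageI openT (fun x _ => Lc x) FUo).
have LfU y : (f @` U) y -> (F @` U) (L y) by rewrite fUE => -[].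
exists U, (g \o L); split=> //; split=> // k.
exact: (Ck_on_comp fUo LfU (Cg k) (Ck_on_linear k _ L)).
Unshelve. all: by end_near. Qed.

End InverseFunction.

(** * Smooth maps between manifolds *)

Section SmoothMaps.
Context {R : realType}.
Implicit Types A M N P : premanifold R.

Lemma Cinfty_on_local m n (W : set 'rV[R]_m) (g : 'rV[R]_m -> 'rV[R]_n) :
  (forall x, W x -> exists V g', [/\ open V, V x, forall y, V y -> g' y = g y &
     Cinfty_on V g']) -> Cinfty_on W g.
Proof.
move=> Wg k; apply: Ck_on_point => x /Wg[V [g' [Vo Vx gg' Cg]]].
by apply: Ck_on_sub (Ck_on_ext Vo gg' (Cg k)) => _ ->.
Qed.

Lemma Cinfty_on_ext m n (W : set 'rV[R]_m) (f g : 'rV[R]_m -> 'rV[R]_n) :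
  open W -> (forall x, W x -> f x = g x) -> Cinfty_on W f -> Cinfty_on W g.
Proof. by move=> Wo fg Cf k; exact: Ck_on_ext (Cf k). Qed.

Lemma Cinfty_on_sub m n (W W' : set 'rV[R]_m) (f : 'rV[R]_m -> 'rV[R]_n) :
  W' `<=` W -> Cinfty_on W f -> Cinfty_on W' f.
Proof. by move=> W'W Cf k; exact: Ck_on_sub (Cf k). Qed.

Lemma Cinfty_on_comp m n p (V : set 'rV[R]_n) (W : set 'rV[R]_m)
    (f : 'rV[R]_n -> 'rV[R]_p) (g : 'rV[R]_m -> 'rV[R]_n) :
  open W -> (forall x, W x -> V (g x)) -> Cinfty_on V f -> Cinfty_on W g ->
  Cinfty_on W (f \o g).
Proof. by move=> Wo WV Cf Cg k; exact: Ck_on_comp (Cf k) (Cg k). Qed.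

Lemma Cinfty_on_linear m n (W : set 'rV[R]_m) (L : {linear 'rV[R]_m -> 'rV[R]_n}) :
  Cinfty_on W L.
Proof. by move=> k; exact: Ck_on_linear. Qed.

Lemma Cinfty_on_add m n (W : set 'rV[R]_m) (f g : 'rV[R]_m -> 'rV[R]_n) :
  open W -> Cinfty_on W f -> Cinfty_on W g -> Cinfty_on W (fun x => f x + g x).
Proof. by move=> Wo Cf Cg k; exact: Ck_on_add. Qed.

Lemma Cinfty_on_row_mx m n p (W : set 'rV[R]_m) (f : 'rV[R]_m -> 'rV[R]_n)
    (g : 'rV[R]_m -> 'rV[R]_p) :
  open W -> Cinfty_on W f -> Cinfty_on W g ->
  Cinfty_on W (fun x => row_mx (f x) (g x)).
Proof.
move=> Wo Cf Cg.
pose L1 : {linear 'rV[R]_n -> 'rV[R]_(n + p)} := mulmxr (row_mx 1%:M 0).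
pose L2 : {linear 'rV[R]_p -> 'rV[R]_(n + p)} := mulmxr (row_mx 0 1%:M).
have C1 := Cinfty_on_comp Wo (fun _ _ => I) (Cinfty_on_linear setT L1) Cf.
have C2 := Cinfty_on_comp Wo (fun _ _ => I) (Cinfty_on_linear setT L2) Cg.
apply: (Cinfty_on_ext Wo _ (Cinfty_on_add Wo C1 C2)) => x _ /=.
by rewrite !mul_mx_row !mulmx1 !mulmx0 add_row_mx addr0 add0r.
Qed.

Lemma chart_img_open (T : topologicalType) n (c : chart R T n) (A : set T) :
  open A -> A `<=` cdom c -> open (fwd c @` A).
Proof.
move=> Ao Ac; have -> : fwd c @` A = fwd c @` cdom c `&` bwd c @^-1` A.
  apply/seteqP; split => [_ [x Ax <-]|_ [[x cx <-]]] /=.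
    by split; [exists x => //; exact: Ac|rewrite fwdK//; exact: Ac].
  by rewrite fwdK// => Ax; exists x.
apply: open_preimageI => //; first exact: cimg_open.
exact: (@bwd_cont _ _ _ c).
Qed.

Lemma smooth_on_sub M N (D D' : set M) (f : M -> N) :
  D' `<=` D -> smooth_on D f -> smooth_on D' f.
Proof.
move=> D'D [fc Cf]; split=> [x /D'D /fc //|c d ac ad].
by apply: Cinfty_on_sub (Cf c d ac ad) => _ [x [[Dx cx] dx] <-]; exists x => //; split=> //; split=> //; exact: D'D.
Qed.

Lemma smooth_on_local M N (D : set M) (f : M -> N) :
  (forall x, D x -> exists V f', [/\ open V, V x, smooth_on V f' &
     forall y, V y -> f' y = f y]) -> smooth_on D f.
Proof.
move=> Df; split=> [x /Df[V [f' [Vo Vx [fc _] ff']]]|c d ac ad].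
  apply: continuous_near_eq (fc x Vx).
  by apply: filterS ff' _; exact: open_nbhs_nbhs.
apply: Cinfty_on_local => _ [x [[/Df[V [f' [Vo Vx [fc Cf] ff']]] cx] dx] <-].
pose Z := (V `&` cdom c) `&` f' @^-1` cdom d.
have Zo : open Z.
  apply: open_preimageI; last exact: cdom_open.
    by apply: openI => //; exact: cdom_open.
  by move=> y [/fc].
exists (fwd c @` Z), (fwd d \o f' \o bwd c); split.
- by apply: chart_img_open => // y [[]].
- by exists x => //; split=> //; rewrite /preimage /= ff'.
- by move=> _ [y [[Vy cy] _] <-]; rewrite /= fwdK// ff'.
- exact: Cf.
Qed.

(** The covering axiom of a manifold, isolated because it is what composition consumes and what has
    to be proved for each submanifold. *)
Definition charted M : Prop := forall x : M, exists2 c, @atlas R M c & cdom c x.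

Lemma smooth_on_comp M N P (D : set M) (D' : set N) (f : M -> N) (g : N -> P) :
  charted N -> open D -> open D' -> smooth_on D f -> smooth_on D' g ->
  smooth_on (D `&` f @^-1` D') (g \o f).
Proof.
move=> Nc Do D'o [fc Cf] [gc Cg]; split=> [x [Dx D'x]|c d ac ad].
  by apply: continuous_comp; [exact: fc|exact: gc].
apply: Cinfty_on_local => _ [x [[[Dx D'fx] cx] dx] <-].
have [e ae efx] := Nc (f x).
pose B := (D' `&` cdom e) `&` g @^-1` cdom d.
have Bo : open B.
  apply: open_preimageI; last exact: cdom_open.
    by apply: openI => //; exact: cdom_open.
  by move=> y [/gc].
pose Z := (D `&` cdom c) `&` f @^-1` B.
have Zo : open Z.
  apply: open_preimageI => //.
    by apply: openI => //; exact: cdom_open.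
  by move=> y [/fc].
have Wo : open (fwd c @` Z) by apply: chart_img_open => // y [[]].
exists (fwd c @` Z), ((fwd d \o g \o bwd e) \o (fwd e \o f \o bwd c)); split=> //.
- by exists x.
- by move=> _ [y [[Dy cy] [[D'y ey] dy]] <-] /=; rewrite !fwdK.
apply: (Cinfty_on_comp Wo _ (Cg e d ae ad)).
  move=> _ [y [[Dy cy] By] <-] /=; exists (f y) => //.
  by rewrite fwdK.
apply: Cinfty_on_sub (Cf c e ac ae) => _ [y [Dcy [[_ ey] _]] <-].
by exists y.
Qed.

Lemma smooth_comp M N P (f : M -> N) (g : N -> P) :
  charted N -> smooth f -> smooth g -> smooth (g \o f).
Proof.
move=> Nc sf sg; apply: smooth_on_sub (smooth_on_comp Nc openT openT sf sg) => x _.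
by split.
Qed.

Lemma smooth_cst M N (a : N) : @smooth R M N (fun=> a).
Proof.
split=> [x _|c d ac ad]; first exact: cst_continuous.
move=> k; exact: Ck_on_cst.
Qed.

(* Compatibility of the charts is smoothness of the identity. *)
Definition atlased M : Prop := charted M /\ smooth (@id M).

Lemma manifold_atlased M : is_manifold M -> atlased M.
Proof.
move=> hM; split; first exact: mfd_cover hM.
split=> [x _|c d ac ad]; first by move=> A.
apply: Cinfty_on_sub (mfd_compatible hM ac ad) => _ [x [[_ cx] dx] <-].
by exists x.
Qed.

Lemma atlased_compatible M c d : atlased M -> @atlas R M c -> @atlas R M d ->
  compatible c d.
Proof.
move=> [_ [_ Cid]] ac ad; apply: Cinfty_on_sub (Cid c d ac ad) => _ [x [cx dx] <-].
by exists x.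
Qed.

Lemma smooth_on_pair A M N (D : set A) (f : A -> M) (g : A -> N) :
  open D -> smooth_on D f -> smooth_on D g ->
  @smooth_on R A (prod_manifold M N) D (fun x => (f x, g x)).
Proof.
move=> Do [fc Cf] [gc Cg].
have hc x : D x -> {for x, continuous (fun x => (f x, g x))}.
  by move=> Dx; apply: continuous_pair; [exact: fc|exact: gc].
split=> // c d ac [d1 [d2 [ad1 ad2 dE fE]]].
set W := fwd c @` _; have Wo : open W.
  apply: chart_img_open => [|x [[]//]].
  apply: open_preimageI; last exact: cdom_open.
    by apply: openI => //; exact: cdom_open.
  by move=> x [/hc].
have C1 := Cinfty_on_sub _ (Cf c d1 ac ad1).
have C2 := Cinfty_on_sub _ (Cg c d2 ac ad2).
apply: (Cinfty_on_ext Wo _ (Cinfty_on_row_mx Wo (C1 W _) (C2 W _))).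
- by move=> _ [x [[Dx cx] dx] <-] /=; rewrite fE ?fwdK.
- by move=> _ [x [[Dx cx] dx] <-]; exists x => //; split=> //; move: dx; rewrite /preimage /= dE => -[].
- by move=> _ [x [[Dx cx] dx] <-]; exists x => //; split=> //; move: dx; rewrite /preimage /= dE => -[].
Qed.

Lemma smooth_pair A M N (f : A -> M) (g : A -> N) :
  smooth f -> smooth g -> @smooth R A (prod_manifold M N) (fun x => (f x, g x)).
Proof. exact/smooth_on_pair/openT. Qed.

Lemma fst_continuous (T U : topologicalType) (x : T * U) : {for x, continuous fst}.
Proof. exact: cvg_fst. Qed.

Lemma snd_continuous (T U : topologicalType) (x : T * U) : {for x, continuous snd}.
Proof. exact: cvg_snd. Qed.

(** In charts this is [lsubmx] followed by the transition from the first factor of the product chart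
    to the chart [d], hence the need for compatible charts on [M]. *)
Lemma smooth_fst M N : atlased M -> @smooth R (prod_manifold M N) M fst.
Proof.
move=> aM; split=> [x _|c d [c1 [c2 [ac1 ac2 cE fE]]] ad].
  exact: fst_continuous.
set W := fwd c @` _; have Wo : open W.
  apply: chart_img_open => [|x [[]//]].
  apply: open_preimageI; last exact: cdom_open.
    by apply: openI; [exact: openT|exact: cdom_open].
  by move=> x _; exact: fst_continuous.
pose L : {linear 'rV[R]_(mdim M + mdim N) -> 'rV[R]_(mdim M)} := lsubmx.
have WV y : W y -> (fwd c1 @` (cdom c1 `&` cdom d)) (L y).
  move=> [x [[_ cx] dx] <-]; exists x.1; last by rewrite fE// /L /= row_mxKl.
  by split=> //; move: cx; rewrite cE => -[].
apply: (Cinfty_on_ext Wo _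
  (Cinfty_on_comp Wo WV (atlased_compatible aM ac1 ad) (Cinfty_on_linear W L))).
move=> _ [x [[_ cx] dx] <-] /=; rewrite fwdK// fE// /L /= row_mxKl fwdK//.
by move: cx; rewrite cE => -[].
Qed.

Lemma smooth_snd M N : atlased N -> @smooth R (prod_manifold M N) N snd.
Proof.
move=> aN; split=> [x _|c d [c1 [c2 [ac1 ac2 cE fE]]] ad].
  exact: snd_continuous.
set W := fwd c @` _; have Wo : open W.
  apply: chart_img_open => [|x [[]//]].
  apply: open_preimageI; last exact: cdom_open.
    by apply: openI; [exact: openT|exact: cdom_open].
  by move=> x _; exact: snd_continuous.
pose L : {linear 'rV[R]_(mdim M + mdim N) -> 'rV[R]_(mdim N)} := rsubmx.
have WV y : W y -> (fwd c2 @` (cdom c2 `&` cdom d)) (L y).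
  move=> [x [[_ cx] dx] <-]; exists x.2; last by rewrite fE// /L /= row_mxKr.
  by split=> //; move: cx; rewrite cE => -[].
apply: (Cinfty_on_ext Wo _
  (Cinfty_on_comp Wo WV (atlased_compatible aN ac2 ad) (Cinfty_on_linear W L))).
move=> _ [x [[_ cx] dx] <-] /=; rewrite fwdK// fE// /L /= row_mxKr fwdK//.
by move: cx; rewrite cE => -[].
Qed.

Section ProductChart.
Variables (T U : topologicalType) (m n : nat) (c : chart R T m) (d : chart R U n).

Let pfwd (x : T * U) := row_mx (fwd c x.1) (fwd d x.2).
Let pbwd (y : 'rV[R]_(m + n)) := (bwd c (lsubmx y), bwd d (rsubmx y)).

Let pimg : pfwd @` (cdom c `*` cdom d) =
  lsubmx @^-1` (fwd c @` cdom c) `&` rsubmx @^-1` (fwd d @` cdom d).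
Proof.
apply/seteqP; split => [_ [x [cx dx] <-]|y [[x cx xE] [x' dx' x'E]]].
  by split; rewrite /preimage /= ?row_mxKl ?row_mxKr; [exists x.1|exists x.2].
by exists (x, x') => //; rewrite /pfwd /= xE x'E hsubmxK.
Qed.

Let popen : open (cdom c `*` cdom d).
Proof.
have := open_preimageI (open_preimageI openT (fun x _ => @fst_continuous T U x) (cdom_open c))
  (fun x _ => @snd_continuous T U x) (cdom_open d).
by rewrite setTI.
Qed.

Let lsub_cont (y : 'rV[R]_(m + n)) : {for y, continuous (lsubmx : _ -> 'rV[R]_m)}.
Proof. exact: rV_linear_continuous. Qed.

Let rsub_cont (y : 'rV[R]_(m + n)) : {for y, continuous (rsubmx : _ -> 'rV[R]_n)}.
Proof. exact: rV_linear_continuous. Qed.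

Let pimg_open : open (pfwd @` (cdom c `*` cdom d)).
Proof.
rewrite pimg; apply: open_preimageI => [|x _|]; last exact: cimg_open.
  by rewrite -[X in open X]setTI; apply: open_preimageI => //; [exact: openT|exact: cimg_open].
exact: rsub_cont.
Qed.

Let pfwd_cont x : (cdom c `*` cdom d) x -> {for x, continuous pfwd}.
Proof.
move=> [cx dx].
have -> : pfwd = fun x => fwd c x.1 *m row_mx 1%:M 0 + fwd d x.2 *m row_mx 0 1%:M.
  apply/funext => z.
  by rewrite /pfwd !mul_mx_row !mulmx1 !mulmx0 add_row_mx addr0 add0r.
apply: continuousD.
- have c1 := continuous_comp (@fst_continuous T U x) (fwd_cont cx).
  exact: (continuous_comp c1 (@rV_linear_continuous R _ _ (mulmxr (row_mx 1%:M 0)) _)).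
- have c2 := continuous_comp (@snd_continuous T U x) (fwd_cont dx).
  exact: (continuous_comp c2 (@rV_linear_continuous R _ _ (mulmxr (row_mx 0 1%:M)) _)).
Qed.

Let pbwd_cont y : (pfwd @` (cdom c `*` cdom d)) y -> {for y, continuous pbwd}.
Proof.
rewrite pimg => -[yl yr]; apply: continuous_pair.
- exact: (continuous_comp (@lsub_cont y) (bwd_cont yl)).
- exact: (continuous_comp (@rsub_cont y) (bwd_cont yr)).
Qed.

Let pfwdK x : (cdom c `*` cdom d) x -> pbwd (pfwd x) = x.
Proof.
by move=> [cx dx]; rewrite /pbwd /pfwd row_mxKl row_mxKr !fwdK//; case: x cx dx.
Qed.

Definition prod_chart : chart R (T * U)%type (m + n) :=
  Chart popen pimg_open pfwd_cont pbwd_cont pfwdK.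

End ProductChart.

Lemma prod_chart_atlas M N c d : @atlas R M c -> @atlas R N d ->
  @atlas R (prod_manifold M N) (prod_chart c d).
Proof. by move=> ac ad; exists c, d. Qed.

Lemma prod_charted M N : charted M -> charted N -> charted (prod_manifold M N).
Proof.
move=> Mc Nc [x y]; have [c ac cx] := Mc x; have [d ad dy] := Nc y.
by exists (prod_chart c d); [exact: prod_chart_atlas|].
Qed.

Lemma prod_atlased M N : atlased M -> atlased N -> atlased (prod_manifold M N).
Proof.
move=> aM aN; split; first by apply: prod_charted; [case: aM|case: aN].
have := smooth_pair (smooth_fst N aM) (smooth_snd M aN).
by congr (@smooth _ _ _ _); apply/funext => -[].
Qed.

(** Slice charts lie only in the maximal atlas, whereas [smooth_on] tests charts of the atlas. The
    gap is bridged by an atlas chart at [f x] and its transition to [d]. *)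
Lemma smooth_on_maximal M N (D : set M) (f : M -> N) c d :
  charted N -> open D -> smooth_on D f -> @atlas R M c -> @maximal_atlas R N d ->
  Cinfty_on (fwd c @` (D `&` cdom c `&` f @^-1` cdom d)) (fwd d \o f \o bwd c).
Proof.
move=> Nc Do [fc Cf] ac md.
apply: Cinfty_on_local => _ [x [[Dx cx] dx] <-].
have [e ae efx] := Nc (f x).
pose Z := (D `&` cdom c) `&` f @^-1` (cdom e `&` cdom d).
have Zo : open Z.
  apply: open_preimageI => [|y [/fc]//|].
    by apply: openI => //; exact: cdom_open.
  by apply: openI; exact: cdom_open.
have Wo : open (fwd c @` Z) by apply: chart_img_open => // y [[]].
exists (fwd c @` Z), ((fwd d \o bwd e) \o (fwd e \o f \o bwd c)); split=> //.
- by exists x.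
- by move=> _ [y [[Dy cy] [ey dy]] <-] /=; rewrite !fwdK.
apply: (Cinfty_on_comp Wo _ (md e ae).2).
  by move=> _ [y [[Dy cy] [ey dy]] <-] /=; exists (f y) => //; rewrite fwdK.
apply: Cinfty_on_sub (Cf c e ac ae) => _ [y [Dcy [ey _]] <-].
by exists y.
Qed.

End SmoothMaps.

(** * Submanifolds and fibre products *)

Section Submanifolds.
Context {R : realType}.
Variables (M : premanifold R) (A : set M) (k : nat).
Let S : premanifold R := submanifold A k.
Let m := mdim M.

Lemma set_val_continuous (a : S) : {for a, continuous (val : S -> M)}.
Proof. exact: initial_continuous. Qed.

Lemma continuous_set_type (T : topologicalType) (f : T -> S) (x : T) :
  {for x, continuous (val \o f : T -> M)} -> {for x, continuous f}.
Proof.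
move=> fc U [V [[W Wo WV] Vfx VU]].
have : nbhs x ((val \o f) @^-1` W).
  by apply: fc; apply: open_nbhs_nbhs; split=> //; rewrite -WV in Vfx.
by apply: filterS => y Wy; apply: VU; rewrite -WV.
Qed.

(** Extension by zeros and truncation to the first [m - k] coordinates. Written as products with a
    rectangular identity matrix, they are linear and therefore smooth. *)
Definition slice_pad : {linear 'rV[R]_(m - k) -> 'rV[R]_m} := mulmxr (pid_mx (m - k)).
Definition slice_proj : {linear 'rV[R]_m -> 'rV[R]_(m - k)} := mulmxr (pid_mx (m - k)).

Lemma slice_projE (y : 'rV[R]_m) (i : 'I_(m - k)) :
  slice_proj y 0 i = y 0 (widen_ord (leq_subr k m) i).
Proof.
rewrite /slice_proj /= mxE (bigD1 (widen_ord (leq_subr k m) i))//= big1 => [|j ji].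
  by rewrite mxE/= eqxx ltn_ord mulr1 addr0.
by rewrite mxE (_ : (j == i :> nat) = false) ?mulr0//; apply: contraNF ji => /eqP ji; apply/eqP/val_inj.
Qed.

Lemma slice_padE (y : 'rV[R]_(m - k)) (j : 'I_m) (i : 'I_(m - k)) :
  i = j :> nat -> slice_pad y 0 j = y 0 i.
Proof.
move=> ij; rewrite /slice_pad /= mxE (bigD1 i)//= big1 => [|l li].
  by rewrite mxE/= ij eqxx -ij ltn_ord mulr1 addr0.
by rewrite mxE -ij (_ : (l == i :> nat) = false) ?mulr0//; exact: negPf.
Qed.

Lemma slice_pad0 (y : 'rV[R]_(m - k)) (j : 'I_m) : (m - k <= j)%N -> slice_pad y 0 j = 0.
Proof.
move=> kj; rewrite /slice_pad /= mxE big1 // => l _.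
rewrite mxE (_ : (l == j :> nat) = false) ?mulr0//.
by apply/negbTE; rewrite neq_ltn (leq_trans (ltn_ord l) kj).
Qed.

Lemma slice_padK : cancel slice_pad slice_proj.
Proof. by move=> y; apply/rowP => i; rewrite slice_projE (slice_padE _ (i := i)). Qed.

Lemma slice_projK (y : 'rV[R]_m) :
  (forall j : 'I_m, (m - k <= j)%N -> y 0 j = 0) -> slice_pad (slice_proj y) = y.
Proof.
move=> y0; apply/rowP => j; have [kj|jk] := leqP (m - k) j.
  by rewrite slice_pad0// y0.
rewrite (slice_padE _ (i := Ordinal jk))// slice_projE; congr (y 0 _).
exact: val_inj.
Qed.

Definition is_slice (d : chart R M m) : Prop :=
  forall x, cdom d x ->
    (A x <-> forall i : 'I_m, (m - k <= i)%N -> fwd d x 0 i = 0).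

Lemma submanifold_atlasP (c : chart R S (mdim S)) : atlas c ->
  exists2 d, @maximal_atlas R M d & [/\ is_slice d, cdom c = [set a | cdom d (val a)] &
    forall a, cdom c a -> fwd c a = slice_proj (fwd d (val a))].
Proof.
move=> [d md [sd cE fE]]; exists d => //; split=> // a ca.
by apply/rowP => i; rewrite slice_projE; apply: fE.
Qed.

Lemma slice_pad_fwd (d : chart R M m) (a : S) :
  is_slice d -> cdom d (val a) -> slice_pad (slice_proj (fwd d (val a))) = fwd d (val a).
Proof. by move=> sd da; apply: slice_projK; exact: (sd _ da).1 (sub_ax a). Qed.

Lemma smooth_val : @smooth R S M val.
Proof.
split=> [a _|c e ac ae]; first exact: set_val_continuous.
have [d md [sd cE fE]] := submanifold_atlasP ac.
set W := fwd c @` _; have Wo : open W.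
  apply: chart_img_open => [|x [[]//]].
  apply: open_preimageI; last exact: cdom_open.
    by apply: openI; [exact: openT|exact: cdom_open].
  by move=> x _; exact: set_val_continuous.
have padE a : cdom c a -> slice_pad (fwd c a) = fwd d (val a).
  move=> ca; rewrite fE// slice_pad_fwd//.
  by move: ca; rewrite cE.
have WV y : W y -> (fwd d @` (cdom d `&` cdom e)) (slice_pad y).
  move=> [a [[_ ca] ea] <-]; exists (val a); last by rewrite padE.
  by split=> //; move: ca; rewrite cE.
apply: (Cinfty_on_ext Wo _
  (Cinfty_on_comp Wo WV (md e ae).1 (Cinfty_on_linear W slice_pad))).
move=> _ [a [[_ ca] ea] <-]; rewrite /comp padE// !fwdK//.
by move: ca; rewrite cE.
Qed.

(** In a slice chart [f] is its ambient expression followed by the linear truncation [slice_proj],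
    so smoothness into a submanifold can be tested in the ambient manifold. *)
Lemma smooth_on_sub_val (N : premanifold R) (D : set N) (f : N -> S) :
  charted M -> open D -> @smooth_on R N M D (val \o f) -> smooth_on D f.
Proof.
move=> Mc Do sf; have [vc _] := sf.
have fc x : D x -> {for x, continuous f} by move=> Dx; apply/continuous_set_type/vc.
split=> // c c' ac ac'.
have [d md [sd cE fE]] := submanifold_atlasP ac'.
set W := fwd c @` _; have Wo : open W.
  apply: chart_img_open => [|x [[]//]].
  apply: open_preimageI; last exact: cdom_open.
    by apply: openI => //; exact: cdom_open.
  by move=> x [/fc].
have Cf : Cinfty_on W (fwd d \o (val \o f) \o bwd c).
  apply: Cinfty_on_sub (smooth_on_maximal Mc Do sf ac md) => _ [x [Dcx c'x] <-].
  by exists x => //; split=> //; move: c'x; rewrite /preimage /= cE.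
apply: (Cinfty_on_ext Wo _ (Cinfty_on_comp Wo (fun _ _ => I) (Cinfty_on_linear setT slice_proj) Cf)).
by move=> _ [x [[Dx cx] c'x] <-]; rewrite /comp fwdK// fE.
Qed.

Lemma submanifold_atlased : charted M -> charted S -> atlased S.
Proof.
by move=> Mc Sc; split=> //; apply: smooth_on_sub_val Mc openT _; exact: smooth_val.
Qed.

Section SliceChart.
Variables (d : chart R M m) (a0 : S).
Hypothesis sd : is_slice d.

Let ddom : set S := [set a | cdom d (val a)].
Let dfwd (a : S) := slice_proj (fwd d (val a)).
(** The inverse of a chart has to be total: [insubd] falls back on [a0] where the ambient inverse
    leaves [A]. *)
Let dbwd (y : 'rV[R]_(m - k)) : S := insubd a0 (bwd d (slice_pad y)).

Let dfwdK a : ddom a -> dbwd (dfwd a) = a.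
Proof.
move=> da; by rewrite /dbwd /dfwd slice_pad_fwd// fwdK// valKd.
Qed.

Let dopen : open ddom.
Proof.
have := open_preimageI openT (fun x _ => @set_val_continuous x) (cdom_open d).
by rewrite setTI.
Qed.

Let dimgP y : (dfwd @` ddom) y <-> (fwd d @` cdom d) (slice_pad y).
Proof.
split=> [[a da <-]|[z dz zE]].
  by exists (val a) => //; rewrite slice_pad_fwd.
have Az : A z by apply/(sd dz) => i ki; rewrite zE slice_pad0.
exists (sub_mk Az) => //; rewrite /dfwd/= zE; exact: slice_padK.
Qed.

Let pad_cont (y : 'rV[R]_(m - k)) : {for y, continuous slice_pad}.
Proof. exact: rV_linear_continuous. Qed.

Let dimg_open : open (dfwd @` ddom).
Proof.
have -> : dfwd @` ddom = setT `&` slice_pad @^-1` (fwd d @` cdom d).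
  by apply/seteqP; split => y => [/dimgP|[_ /dimgP]].
by apply: (open_preimageI openT) => [y _|]; [exact: pad_cont|exact: cimg_open].
Qed.

Let dfwd_cont a : ddom a -> {for a, continuous dfwd}.
Proof.
move=> da; have c1 := continuous_comp (@set_val_continuous a) (fwd_cont da).
exact: (continuous_comp c1 (@rV_linear_continuous R _ _ slice_proj _)).
Qed.

Let dbwd_cont y : (dfwd @` ddom) y -> {for y, continuous dbwd}.
Proof.
move=> dy; apply: continuous_set_type.
have c1 := continuous_comp (@pad_cont y) (bwd_cont ((dimgP y).1 dy)).
apply: continuous_near_eq c1; apply: filterS (open_nbhs_nbhs (conj dimg_open dy)).
by move=> _ [a da <-]; rewrite /comp dfwdK// /dfwd slice_pad_fwd// fwdK.
Qed.

Definition slice_chart : chart R S (m - k) :=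
  Chart dopen dimg_open dfwd_cont dbwd_cont dfwdK.

Lemma slice_chart_atlas : @maximal_atlas R M d -> @atlas R S slice_chart.
Proof.
move=> md; exists d => //; split=> // a i j _ ij.
by rewrite [LHS]slice_projE; congr (fwd _ _ _ _); apply: val_inj.
Qed.

End SliceChart.

End Submanifolds.

(** * Slice charts for level sets and fibre products *)

Section RegularLevelSets.
Context {R : realType}.

Lemma cast_rVE m n (e : n = m) (u : 'rV[R]_n) (j : 'I_m) :
  (u *m castmx (erefl, e) 1%:M) 0 j = u 0 (cast_ord (esym e) j).
Proof. by case: _ / e j => j; rewrite castmx_id mulmx1 cast_ord_id. Qed.

Lemma cast_rV_inj m n (e : n = m) (u : 'rV[R]_n) :
  u *m castmx (erefl, e) 1%:M = 0 -> u = 0.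
Proof. by case: _ / e; rewrite castmx_id mulmx1. Qed.

(** [Q] computes coordinates in a basis of the kernel of [B], by a pseudo-inverse of that basis. The
    cast is needed because the basis has \rank (kermx B) rows, which equals [m - k] only by
    rank-nullity. *)
Lemma kernel_coordinates m k (B : 'M[R]_(m, k)) :
  \rank B = k -> exists Q : 'M[R]_(m, m - k), forall v : 'rV_m,
    v *m B = 0 -> v *m Q = 0 -> v = 0.
Proof.
move=> rB; have rK : \rank (kermx B) = (m - k)%N by rewrite mxrank_ker rB.
exists (castmx (erefl, rK) (pinvmx (row_base (kermx B)))) => v vB.
have vK : (v <= row_base (kermx B))%MS by rewrite eq_row_base; apply/sub_kermxP.
rewrite -[v in X in X -> _](mulmxKpV vK) => vQ.
have {vQ} : v *m pinvmx (row_base (kermx B)) = 0.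
  move: vQ; rewrite mulmxKpV//; case: _ / rK; by rewrite castmx_id.
by move=> v0; rewrite -(mulmxKpV vK) v0 mul0mx.
Qed.

Lemma surj_lin1_rank m k (L : {linear 'rV[R]_m -> 'rV[R]_k}) :
  (forall w, exists v, L v = w) -> \rank (lin1_mx L) = k.
Proof.
move=> Ls; apply/eqP; rewrite -[_ == _]/(row_full _) -sub1mx.
apply/row_subP => i; have [v Lv] := Ls (row i 1%:M).
by rewrite -Lv -mul_rV_lin1 submxMl.
Qed.

Section ChartComp.
Variables (T : topologicalType) (n : nat) (c : chart R T n).
Variables (U : set 'rV[R]_n) (Phi g : 'rV[R]_n -> 'rV[R]_n).
Hypotheses (Uo : open U) (Uc : U `<=` fwd c @` cdom c) (PUo : open (Phi @` U)).
Hypotheses (CPhi : Cinfty_on U Phi) (Cg : Cinfty_on (Phi @` U) g).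
Hypothesis gK : forall y, U y -> g (Phi y) = y.

Let rdom := cdom c `&` fwd c @^-1` U.
Let rfwd := Phi \o fwd c.
Let rbwd := bwd c \o g.

Let rdom_open : open rdom.
Proof. exact: (open_preimageI (cdom_open c) (fun x => @fwd_cont _ _ _ c x) Uo). Qed.

Let rimgE : rfwd @` rdom = Phi @` U.
Proof.
apply/seteqP; split => [_ [x [_ Ux] <-]|_ [y Uy <-]]; first by exists (fwd c x).
by have [x cx xy] := Uc Uy; exists x; rewrite /rdom /rfwd /= ?xy.
Qed.

Let rimg_open : open (rfwd @` rdom).
Proof. by rewrite rimgE. Qed.

Let rfwd_cont x : rdom x -> {for x, continuous rfwd}.
Proof.
move=> [cx Ux].
exact: (continuous_comp (fwd_cont cx) (Ck_on_continuous (CPhi 0) Ux)).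
Qed.

Let rbwd_cont y : (rfwd @` rdom) y -> {for y, continuous rbwd}.
Proof.
rewrite rimgE => Py; have := Ck_on_continuous (Cg 0) Py; case: Py => z Uz <- gc.
apply: (continuous_comp gc); rewrite gK//; apply: bwd_cont; exact: Uc.
Qed.

Let rfwdK x : rdom x -> rbwd (rfwd x) = x.
Proof. by move=> [cx Ux]; rewrite /rbwd /rfwd /= gK// fwdK. Qed.

Definition chart_comp : chart R T n := Chart rdom_open rimg_open rfwd_cont rbwd_cont rfwdK.

(** The new transition maps are the old ones composed with [g] on one side and [Phi] on the other;
    so modifying an atlas chart by a local diffeomorphism stays in the maximal atlas. *)
Lemma chart_comp_compatible (e : chart R T n) :
  compatible c e -> compatible e c -> compatible chart_comp e /\ compatible e chart_comp.
Proof.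
move=> ce ec; have oI := openI rdom_open (cdom_open e); split.
  have Wo : open (rfwd @` (rdom `&` cdom e)).
    by apply: (@chart_img_open _ _ _ chart_comp) => // y [].
  apply: (Cinfty_on_comp Wo _ ce).
    by move=> _ [x [[cx Ux] ex] <-]; exists x; rewrite // /rfwd /= gK.
  apply: Cinfty_on_sub Cg => _ [x [[_ Ux] _] <-].
  by exists (fwd c x).
have Wo : open (fwd e @` (cdom e `&` rdom)).
  by apply: chart_img_open => [|y []//]; rewrite setIC.
apply: (Cinfty_on_comp Wo _ CPhi).
  by move=> _ [x [ex [cx Ux]] <-]; rewrite /= fwdK.
by apply: Cinfty_on_sub ec => _ [x [ex [cx Ux]] <-]; exists x.
Qed.

End ChartComp.

(* Near [x], [(u, sigma)] with [u] linear coordinates on the kernel of the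
   differential of [sigma] is a chart, by the inverse function theorem. *)
Lemma regular_level_chart (M : premanifold R) (A : set M) k
    (a : submanifold A k) (c : chart R M (mdim M)) (D : set M) (sigma : M -> 'rV[R]_k) :
  atlased M -> atlas c -> cdom c (val a) -> open D -> D (val a) ->
  Cinfty_on (fwd c @` (D `&` cdom c)) (sigma \o bwd c) ->
  (forall y, D y -> (A y <-> sigma y = 0)) ->
  (forall w, exists v, 'd (sigma \o bwd c) (fwd c (val a)) v = w) ->
  exists2 c', @atlas R (submanifold A k) c' & cdom c' a.
Proof.
set x := val a => aM ac cx Do Dx Cs As ds.
pose s := sigma \o bwd c; pose y0 := fwd c x.
have rB := surj_lin1_rank ds; rewrite -/(jacobian s y0) in rB.
have [Q kerQ] := kernel_coordinates rB.
have km : (k <= mdim M)%N by rewrite -[leqLHS]rB rank_leq_row.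
(* Since the rank bounds [k] by the dimension, the truncated subtraction is exact, and [T]
   identifies R^((m-k)+k) with R^m. *)
pose e := subnK km; pose T := castmx (erefl, e) 1%:M : 'M[R]_(mdim M - k + k, mdim M).
pose L1 : {linear 'rV[R]_(mdim M) -> 'rV[R]_(mdim M)} := mulmxr (row_mx Q 0 *m T).
pose L2 : {linear 'rV[R]_k -> 'rV[R]_(mdim M)} := mulmxr (row_mx 0 1%:M *m T).
pose Phi y := L1 y + L2 (s y).
have LE v w : L1 v + L2 w = row_mx (v *m Q) w *m T.
  rewrite /L1 /L2 /= !mulmxA -mulmxDl !mul_mx_row !mulmx0 mulmx1 add_row_mx.
  by rewrite addr0 add0r.
pose W := fwd c @` (D `&` cdom c).
have Wo : open W by apply: chart_img_open => [|y []//]; apply: openI => //; exact: cdom_open.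
have Wy0 : W y0 by exists x.
have CPhi : Cinfty_on W Phi.
  have C2 := Cinfty_on_comp Wo (fun _ _ => I) (Cinfty_on_linear setT L2) Cs.
  exact: (Cinfty_on_add Wo (Cinfty_on_linear W L1) C2).
have dsy : differentiable s y0 by have [df _] := Cs 1; exact: df.
have L1c : continuous L1 by exact: rV_linear_continuous.
have L2c : continuous L2 by exact: rV_linear_continuous.
have dPhi v : 'd Phi y0 v = L1 v + L2 ('d s y0 v).
  have d1 : is_diff y0 L1 L1 by split; [exact: linear_differentiable|exact: diff_lin].
  have d2 : is_diff (s y0) L2 L2 by split; [exact: linear_differentiable|exact: diff_lin].
  have [_ E] := is_diffD d1 (is_diff_comp (differentiableP dsy) d2).
  exact: (congr1 (@^~ v) E).
have Phi_inj : injective ('d Phi y0).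
  move=> v w vw; apply/eqP; rewrite -subr_eq0; apply/eqP.
  have : 'd Phi y0 (v - w) = 0 by rewrite linearB /= vw subrr.
  rewrite dPhi LE => /cast_rV_inj; rewrite -[RHS]row_mx0 => /eq_row_mx[vQ vB].
  by apply: kerQ => //; rewrite mul_rV_lin1.
have [U [g [Uo Uy0 UW PUo [gK Cg]]]] := inverse_function Wo Wy0 CPhi Phi_inj.
have Uc : U `<=` fwd c @` cdom c by move=> y /UW[z [_ cz] <-]; exists z.
have CU := Cinfty_on_sub UW CPhi.
pose d := chart_comp Uo Uc PUo CU Cg gK.
have md : @maximal_atlas R M d.
  by move=> f af; apply: chart_comp_compatible; exact: atlased_compatible.
(* [sigma] was put in the last [k] coordinates of [Phi] precisely so that their vanishing describes
   [A]. *)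
have sd : is_slice A k d.
  move=> y [cy Uy]; have Dy : D y.
    by have [z [Dz cz] /(congr1 (bwd c))] := UW _ Uy; rewrite !fwdK// => <-.
  rewrite (As y Dy) /=; have -> : Phi (fwd c y) = row_mx (fwd c y *m Q) (sigma y) *m T.
    by rewrite /Phi LE /s /= fwdK.
  split=> [-> i ki|sy].
    rewrite cast_rVE; case: (splitP (cast_ord (esym e) i)) => [j /= ij|j ij].
      by move: ki; rewrite ij leqNgt ltn_ord.
    rewrite (_ : cast_ord _ _ = rshift _ j); last exact: val_inj.
    by rewrite row_mxEr mxE.
  apply/rowP => j; have := sy (cast_ord e (rshift (mdim M - k) j)) (leq_addr _ _).
  by rewrite cast_rVE cast_ordK row_mxEr mxE.
exists (slice_chart a sd); first exact: slice_chart_atlas.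
by split.
Qed.

End RegularLevelSets.

Section FibreProducts.
Context {R : realType}.

Lemma smooth_coordinates (M N : premanifold R) (f : M -> N) c psi (D : set M) :
  atlased M -> smooth f -> @atlas R M c -> @atlas R N psi ->
  D `<=` f @^-1` cdom psi ->
  Cinfty_on (fwd c @` (D `&` cdom c)) ((fwd psi \o f) \o bwd c).
Proof.
move=> aM [_ Cf] ac apsi Dpsi; apply: Cinfty_on_sub (Cf c psi ac apsi).
by move=> _ [x [Dx cx] <-]; exists x => //; split=> //; exact: Dpsi.
Qed.

Lemma chart_differentiable (M N : premanifold R) (f : M -> N) c psi (x : M) :
  smooth f -> @atlas R M c -> @atlas R N psi -> cdom c x -> cdom psi (f x) ->
  differentiable (fwd psi \o f \o bwd c) (fwd c x).
Proof.
by move=> [_ Cf] ac apsi cx px; have [df _] := Cf c psi ac apsi 1; apply: df; exists x.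
Qed.

(** The local equation is psi (f x) - psi y for a chart [psi] at [y]; on the preimage of the domain
    of [psi], injectivity of [psi] makes its zeros exactly the level set. *)
Lemma level_charted (M N : premanifold R) (f : M -> N) (y : N) :
  atlased M -> charted N -> submersion f ->
  charted (submanifold [set x | f x = y] (mdim N)).
Proof.
move=> aM Nc [sf df] a; have [Mc _] := aM; have [fc _] := sf.
have [c ac ca] := Mc (val a); have [psi apsi psiy] := Nc y.
have fa : f (val a) = y := sub_ax a.
have psifa : cdom psi (f (val a)) by rewrite fa.
pose D := setT `&` f @^-1` cdom psi.
have Do : open D by exact: (open_preimageI openT fc (cdom_open psi)).
pose tau x := fwd psi (f x) - fwd psi y.
have Wo : open (fwd c @` (D `&` cdom c)).
  by apply: chart_img_open => [|z []//]; apply: openI => //; exact: cdom_open.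
apply: (@regular_level_chart R M _ _ a c D tau) => //.
- have C1 : Cinfty_on (fwd c @` (D `&` cdom c)) ((fwd psi \o f) \o bwd c).
    by apply: smooth_coordinates => // z [].
  exact: (Cinfty_on_add Wo C1 (fun k => Ck_on_cst k _ (- fwd psi y))).
- move=> z [_ pz] /=; rewrite /tau; split=> [->|/eqP]; first by rewrite subrr.
  by rewrite subr_eq0 => /eqP /(congr1 (bwd psi)); rewrite !fwdK.
move=> w; have [v <-] := df _ _ _ ac apsi ca psifa w; exists v.
have dp := chart_differentiable sf ac apsi ca psifa.
have [_ E] := is_diffD (differentiableP dp) (is_diff_cst (- fwd psi y) (fwd c (val a))).
by have := congr1 (@^~ v) E; rewrite /GRing.add/= addr0.
Qed.

(** The local equation is the difference of [f] and [g] in a chart of [C]. Its differential is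
    already onto on vectors (v, 0), where it is the differential of the submersion [f]. *)
Lemma fibprod_charted (A B C : premanifold R) (f : A -> C) (g : B -> C) :
  atlased A -> atlased B -> charted C -> submersion f -> smooth g ->
  charted (fibprod f g).
Proof.
move=> aA aB Cc [sf df] sg a; have [Ac _] := aA; have [Bc _] := aB.
have aAB := prod_atlased aA aB.
pose M := prod_manifold A B.
have [c1 ac1 c1a] := Ac (val a).1; have [c2 ac2 c2a] := Bc (val a).2.
have [psi apsi psia] := Cc (f (val a).1).
have fga : f (val a).1 = g (val a).2 := sub_ax a.
have psiga : cdom psi (g (val a).2) by rewrite -fga.
pose c := prod_chart c1 c2; have ac : @atlas R M c by exact: prod_chart_atlas.
have sf1 : @smooth R M C (f \o fst) by apply: smooth_comp sf => //; exact: smooth_fst.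
have sg2 : @smooth R M C (g \o snd) by apply: smooth_comp sg => //; exact: smooth_snd.
pose D1 : set M := setT `&` (f \o fst) @^-1` cdom psi.
have D1o : open D1 by exact: (open_preimageI openT sf1.1 (cdom_open psi)).
pose D2 : set M := setT `&` (g \o snd) @^-1` cdom psi.
have D2o : open D2 by exact: (open_preimageI openT sg2.1 (cdom_open psi)).
pose D := D1 `&` D2; have Do : open D by exact: openI.
pose tau (x : M) := fwd psi (f x.1) - fwd psi (g x.2).
have Wo : open (fwd c @` (D `&` cdom c)).
  by apply: chart_img_open => [|z []//]; apply: openI => //; exact: cdom_open.
have ca : cdom c (val a) by [].
pose L : {linear 'rV[R]_(mdim C) -> 'rV[R]_(mdim C)} := -%R.
apply: (@regular_level_chart R M _ _ a c D tau) => //.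
- have C1 : Cinfty_on (fwd c @` (D `&` cdom c)) ((fwd psi \o (f \o fst)) \o bwd c).
    by apply: smooth_coordinates => // z [[]].
  have C2 : Cinfty_on (fwd c @` (D `&` cdom c)) ((fwd psi \o (g \o snd)) \o bwd c).
    by apply: smooth_coordinates => // z [_ []].
  have C3 := Cinfty_on_comp Wo (fun _ _ => I) (Cinfty_on_linear setT L) C2.
  exact: (Cinfty_on_add Wo C1 C3).
- move=> z [[_ fz] [_ gz]] /=; rewrite /tau; split=> [->|/eqP]; first by rewrite subrr.
  by rewrite subr_eq0 => /eqP /(congr1 (bwd psi)); rewrite !fwdK.
move=> w; have [v <-] := df _ _ _ ac1 apsi c1a psia w; exists (row_mx v 0).
pose p := fwd psi \o f \o bwd c1; pose q := fwd psi \o g \o bwd c2.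
have dp : differentiable p (fwd c1 (val a).1) by exact: chart_differentiable.
have dq : differentiable q (fwd c2 (val a).2) by exact: chart_differentiable.
pose l : {linear 'rV[R]_(mdim A + mdim B) -> 'rV[R]_(mdim A)} := lsubmx.
pose r : {linear 'rV[R]_(mdim A + mdim B) -> 'rV[R]_(mdim B)} := rsubmx.
set y0 := fwd c (val a).
have dl : is_diff y0 l l.
  by split; [apply: linear_differentiable|apply: diff_lin]; exact: rV_linear_continuous.
have dr : is_diff y0 r r.
  by split; [apply: linear_differentiable|apply: diff_lin]; exact: rV_linear_continuous.
have ly0 : l y0 = fwd c1 (val a).1 by rewrite /l /y0 /= row_mxKl.
have ry0 : r y0 = fwd c2 (val a).2 by rewrite /r /y0 /= row_mxKr.
rewrite -ly0 in dp *; rewrite -ry0 in dq.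
have dpl := is_diff_comp dl (differentiableP dp).
have dqr := is_diff_comp dr (differentiableP dq).
have [_ E] := is_diffB dpl dqr.
have := congr1 (@^~ (row_mx v 0)) E.
rewrite ![in RHS]/GRing.add/= ![in RHS]/GRing.opp/= /l /r /= row_mxKl row_mxKr.
by rewrite linear0 subr0.
Qed.

Lemma fibprod_atlased (A B C : premanifold R) (f : A -> C) (g : B -> C) :
  atlased A -> atlased B -> charted C -> submersion f -> smooth g ->
  atlased (fibprod f g).
Proof.
move=> aA aB Cc sf sg; apply: submanifold_atlased; last exact: fibprod_charted.
by have [] := prod_atlased aA aB.
Qed.

Lemma smooth_fib_fst (A B C : premanifold R) (f : A -> C) (g : B -> C) :
  atlased A -> atlased B -> @smooth R (fibprod f g) A (fun z => (val z).1).
Proof.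
move=> aA aB; apply: (smooth_comp (prod_atlased aA aB).1 (@smooth_val _ _ _ _)).
exact: smooth_fst.
Qed.

Lemma smooth_fib_snd (A B C : premanifold R) (f : A -> C) (g : B -> C) :
  atlased A -> atlased B -> @smooth R (fibprod f g) B (fun z => (val z).2).
Proof.
move=> aA aB; apply: (smooth_comp (prod_atlased aA aB).1 (@smooth_val _ _ _ _)).
exact: smooth_snd.
Qed.

Lemma smooth_fib_pair (N A B C : premanifold R) (f : A -> C) (g : B -> C)
    (h : N -> fibprod f g) :
  charted A -> charted B ->
  @smooth R N A (fun x => (val (h x)).1) -> @smooth R N B (fun x => (val (h x)).2) ->
  smooth h.
Proof.
move=> Ac Bc s1 s2; apply: smooth_on_sub_val (prod_charted Ac Bc) openT _.
have := smooth_pair s1 s2; congr (@smooth_on _ _ _ _ _).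
by apply/funext => x /=; case: (val (h x)).
Qed.

End FibreProducts.

(** * Embeddings and principal bundles *)

Section Embeddings.
Context {R : realType}.

(** By the chain rule the differential of [r] is a left inverse of that of [C], which gives the
    immersion. The preimage of [U] under [r] is the open set that cuts out [U], which gives the
    subspace topology. *)
Lemma left_inverse_embedding (S N : premanifold R) (C : S -> N) (r : N -> S) :
  smooth C -> smooth r -> cancel C r -> embedding C.
Proof.
move=> sC sr CK; split; last 2 first.
- exact: can_inj CK.
- move=> U Uo; exists (setT `&` r @^-1` U).
    exact: (open_preimageI openT sr.1 Uo).
  by apply/seteqP; split=> x /=; rewrite CK; [split|case].
split=> // x c d ac ad cx dx; have [Cc _] := sC.
pose y0 := fwd c x; pose f := fwd d \o C \o bwd c; pose g := fwd c \o r \o bwd d.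
have df : differentiable f y0 by exact: chart_differentiable.
have fy0 : f y0 = fwd d (C x) by rewrite /f /= fwdK.
have dg : differentiable g (f y0).
  by rewrite fy0; apply: chart_differentiable => //; rewrite CK.
pose Z := cdom c `&` C @^-1` cdom d.
have Zo : open Z.
  by apply: (open_preimageI (cdom_open c) _ (cdom_open d)) => z _; exact: Cc.
have Wo : open (fwd c @` Z) by apply: chart_img_open => // z [].
have Wy0 : (fwd c @` Z) y0 by exists x.
(* In charts the identity r o C = id holds only near [y0], which suffices for the differentials. *)
have gf : \forall y \near y0, y = (g \o f) y.
  apply: filterS (open_nbhs_nbhs (conj Wo Wy0)) => _ [z [cz dz] <-].
  by rewrite /g /f /= fwdK// fwdK// CK.
have [_ E1] := near_eq_is_diff gf (@ex_diff _ _ _ _ _ _ _ (is_diff_id y0)).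
have E2 := diff_comp df dg.
have E3 := @diff_val _ _ _ _ _ _ _ (is_diff_id y0).
apply: (@can_inj _ _ _ ('d g (f y0))) => v.
apply: etrans (congr1 (@^~ v) (esym E2)) _.
apply: etrans (congr1 (@^~ v) E1) _.
exact: (congr1 (@^~ v) E3).
Qed.

End Embeddings.

Section PrincipalBundles.
Context {R : realType}.

Section Groups.
Variable G : group_data R.
Hypothesis hG : is_lie_group G.

Lemma gmulKV (a b : G) : gmul a (gmul (ginv a) b) = b.
Proof. by rewrite (lgr_mulA hG) (lgr_mulV hG) (lgr_1mul hG). Qed.

Lemma gmulK (a b : G) : gmul (ginv a) (gmul a b) = b.
Proof. by rewrite (lgr_mulA hG) (lgr_Vmul hG) (lgr_1mul hG). Qed.

Lemma gmul_inj (a : G) : injective (gmul a).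
Proof. by move=> b c /(congr1 (gmul (ginv a))); rewrite !gmulK. Qed.

Lemma ginvK (a : G) : ginv (ginv a) = a.
Proof. by apply: (gmul_inj (a := ginv a)); rewrite (lgr_mulV hG) (lgr_Vmul hG). Qed.

Lemma ginv1 : ginv (gone G) = gone G.
Proof. by rewrite -[LHS](lgr_1mul hG) (lgr_mulV hG). Qed.

End Groups.

Variables (G : group_data R) (P B : premanifold R) (pi : P -> B) (act : P -> G -> P).
Hypothesis pb : is_principal_bundle pi act.
Let hG := pb_group pb.

Lemma principal_free p : injective (act p).
Proof.
move=> g g' pgg'; have [U [tr [tr' [_ Up _ _ [_ _ _ trg]]]]] := pb_trivial pb (pi p).
have := congr1 (fun q => (tr q).2) pgg'.
by rewrite /= !trg// => /(gmul_inj hG).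
Qed.

Lemma principal_transitive p q : pi p = pi q -> exists g, act p g = q.
Proof.
move=> pq; have [U [tr [tr' [_ Up _ _ [trK _ tr1 trg]]]]] := pb_trivial pb (pi p).
set g := gmul (ginv (tr p).2) (tr q).2; exists g.
have Uq : U (pi q) by rewrite -pq.
have Ug : U (pi (act p g)) by rewrite (pb_act_proj pb).
rewrite -(trK _ Ug) -(trK _ Uq); congr (tr' _).
rewrite [LHS]surjective_pairing [RHS]surjective_pairing trg// /g (gmulKV hG).
by rewrite (tr1 _ Ug) (tr1 _ Uq) (pb_act_proj pb) pq.
Qed.

(** In a local trivialisation, equivariance makes d(y) the quotient (tr (f1 y)).2^-1 (tr (f2 y)).2,
    a smooth expression; [f1] and [f2] lie over the same base points, so a single trivialisation
    serves both. *)
Lemma principal_division_smooth (N : premanifold R) (f1 f2 : N -> P) (d : N -> G) :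
  smooth f1 -> smooth f2 -> (forall x, act (f1 x) (d x) = f2 x) -> smooth d.
Proof.
move=> s1 s2 df; apply: smooth_on_local => x _.
have aG := manifold_atlased (lgr_manifold hG).
have aP := manifold_atlased (pb_total pb); have aB := manifold_atlased (pb_base pb).
have [U [tr [tr' [Uo Ux str _ [_ _ _ trg]]]]] := pb_trivial pb (pi (f1 x)).
have pio : open (pi @^-1` U).
  have := open_preimageI openT (pb_proj_smooth pb).1 Uo; by rewrite setTI.
pose V := setT `&` f1 @^-1` (pi @^-1` U).
have Vo : open V by exact: (open_preimageI openT s1.1 pio).
have aBG := prod_atlased aB aG.
have sd (f : N -> P) : smooth f -> (forall y, pi (f y) = pi (f1 y)) ->
    smooth_on V (fun y => (tr (f y)).2).
  move=> sf pf.
  have sV : smooth_on (pi @^-1` U) (fun p => (tr p).2).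
    apply: smooth_on_sub (smooth_on_comp aBG.1 pio openT str (smooth_snd B aG)) => p Up.
    by split.
  apply: smooth_on_sub (smooth_on_comp aP.1 openT pio sf sV) => y [_ Uy].
  by split=> //; rewrite /preimage /= pf.
have t1 := sd f1 s1 (fun=> erefl).
have t2 := sd f2 s2 (fun y => etrans (congr1 pi (esym (df y))) (pb_act_proj pb _ _)).
have t3 := smooth_on_comp aG.1 Vo openT t1 (lgr_inv_smooth hG).
have t4 : smooth_on V (fun y => gmul (ginv (tr (f1 y)).2) (tr (f2 y)).2).
  have sp := smooth_on_pair Vo (smooth_on_sub (fun y Vy => conj Vy I) t3) t2.
  apply: smooth_on_sub
    (smooth_on_comp (prod_atlased aG aG).1 Vo openT sp (lgr_mul_smooth hG)) => y Vy.
  by split.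
exists V, (fun y => gmul (ginv (tr (f1 y)).2) (tr (f2 y)).2); split=> //.
by move=> y [_ Uy]; rewrite -df trg// (gmulK hG).
Qed.

End PrincipalBundles.

Section TwoBundles.
Context {R : realType}.

Lemma inverse_bundle2_morphism (G : two_group_data R) (X : groupoid_data R)
    (E E' : bundle2_data G X) (F0 : obj E -> obj E') (F1 : mor E -> mor E') F0' F1' :
  is_bundle2_morphism F0 F1 -> cancel F0 F0' -> cancel F0' F0 ->
  cancel F1 F1' -> cancel F1' F1 -> smooth F0' -> smooth F1' ->
  @is_bundle2_morphism R G X E' E F0' F1'.
Proof.
move=> [[_ _ Fs Ft Fi Fc] e0 e1 p0 p1] K0 K0' K1 K1' s0 s1; split; first split=> //.
- by move=> f; apply: (can_inj K0); rewrite -Fs K1' K0'.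
- by move=> f; apply: (can_inj K0); rewrite -Ft K1' K0'.
- by move=> x; apply: (can_inj K1); rewrite Fi K1' K0'.
- move=> z w wz; apply: (can_inj K1); rewrite K1'; apply/esym/Fc.
  by rewrite wz !K1'; case: (val z).
- by move=> p g; apply: (can_inj K0); rewrite e0 !K0'.
- by move=> p g; apply: (can_inj K1); rewrite e1 !K1'.
- by move=> p; rewrite -p0 K0'.
- by move=> e; rewrite -p1 K1'.
Qed.

Variables (G : lie_2group R) (X : lie_groupoid R) (E : principal_2bundle G X).
Let hE := p2_ax E.

Lemma act_src (e : mor E) (a : tg1 G) :
  src (b2_act1 e a) = b2_act0 (src e) (tg_src a).
Proof. exact: (gm_src (b2_act_morphism hE) (e, a)). Qed.

Lemma act_tgt (e : mor E) (a : tg1 G) :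
  tgt (b2_act1 e a) = b2_act0 (tgt e) (tg_tgt a).
Proof. exact: (gm_tgt (b2_act_morphism hE) (e, a)). Qed.

(** Functoriality of the action on the product groupoid, read as an interchange law: (e_2 o e_1)(k_2
    o k_1) = (e_2 k_2) o (e_1 k_1). *)
Lemma act_compose (z u : composable E) (w : composable (tg_groupoid G)) :
  val u = (b2_act1 (val z).1 (val w).1, b2_act1 (val z).2 (val w).2) ->
  b2_act1 (compose z) (tg_compose w) = compose u.
Proof.
move=> uE.
have zw : @prod_src R E (tg_groupoid G) ((val z).1, (val w).1) =
          @prod_tgt R E (tg_groupoid G) ((val z).2, (val w).2).
  exact: (f_equal2 pair (sub_ax z) (sub_ax w)).
pose y : composable (prod_groupoid E (tg_groupoid G)) :=
  sub_mk (x := (((val z).1, (val w).1), ((val z).2, (val w).2))) zw.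
have := gm_compose (b2_act_morphism hE) (z := y) (w := u) uE.
move=> <-; congr (b2_act1 _ _); [congr compose|congr (@tg_compose R G _)]; apply: val_inj => /=.
- by case: (val z).
- by case: (val w).
Qed.

End TwoBundles.

(** * Connections and decorated bundles *)

Section Connections.
Context {R : realType}.
Variables (G : lie_2group R) (X : lie_groupoid R) (E : principal_2bundle G X).
Let hX := lgpd_ax X.
Let hG := l2_ax G.
Let hE := p2_ax E.
Let hG0 := tg_group0 hG.
Let hG1 := tg_group1 hG.
Let hGG := tg_lie_groupoid hG.
Let hEE := b2_groupoid hE.
Let K := cm_of_2group G.
Let fibE := fibprod (@src R X) (@b2_proj0 R G X E).

Let aX0 := manifold_atlased (gd_obj hX).
Let aX1 := manifold_atlased (gd_mor hX).
Let aE0 := manifold_atlased (gd_obj hEE).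
Let aE1 := manifold_atlased (gd_mor hEE).
Let aG0 := manifold_atlased (lgr_manifold hG0).
Let aG1 := manifold_atlased (lgr_manifold hG1).

Let tg_idm1 : tg_idm (gone (tg0 G)) = gone (tg1 G).
Proof. exact: hom1 hG0 hG1 (tg_idm_hom hG). Qed.

Let tg_src_idm g : tg_src (tg_idm g) = g :> tg0 G.
Proof. exact: (gd_src_idm hGG). Qed.

Let tg_tgt_idm g : tg_tgt (tg_idm g) = g :> tg0 G.
Proof. exact: (gd_tgt_idm hGG). Qed.

Lemma gbundle_fib_atlased (P : gbundle (tg0 G) X) :
  atlased (fibprod (@src R X) (@gb_proj _ _ _ P)).
Proof.
have pb := gb_principal (gb_ax P).
apply: fibprod_atlased (gd_src_sub hX) (pb_proj_smooth pb) => //; last by case: aX0.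
exact: manifold_atlased (pb_total pb).
Qed.

Lemma ker_group_atlased : atlased (ker_group G).
Proof.
have ch := level_charted (y := gone (tg0 G)) aG1 aG0.1 (gd_src_sub hGG).
by apply: submanifold_atlased ch; case: aG1.
Qed.

Lemma dec_mor_atlased (P : gbundle (tg0 G) X) :
  atlased (@dec_mor R K X P).
Proof. exact: prod_atlased (gbundle_fib_atlased P) ker_group_atlased. Qed.

Let fib_rho_ax (e : mor E) : src (b2_proj1 e) = b2_proj0 (src e).
Proof. exact: gm_src (b2_proj_morphism hE) e. Qed.

Definition fib_rho (e : mor E) : fibE := sub_mk (x := (b2_proj1 e, src e)) (fib_rho_ax e).

Lemma fib_rho_smooth : smooth fib_rho.
Proof.
apply: smooth_fib_pair; [by case: aX1|by case: aE0| |].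
- exact: gm_smooth1 (b2_proj_morphism hE).
- exact: (gd_src_sub hEE).1.
Qed.

(** * The connection induced by an isomorphism with a decorated bundle *)

Section FromDecorated.
Variables (P : gbundle (tg0 G) X).
Let E' := restrict_2group (@cm_iso0 R G) (@cm_iso1 R G) E.
Let D := @decorated R K X P.
Variables (F0 : obj E' -> obj D) (F1 : mor E' -> mor D).
Variables (F0' : obj D -> obj E') (F1' : mor D -> mor E').
Hypotheses (mF : is_bundle2_morphism F0 F1) (mF' : is_bundle2_morphism F0' F1').
Hypotheses (F0K : cancel F0 F0') (F0'K : cancel F0' F0).
Let fibP := fibprod (@src R X) (@gb_proj _ _ _ P).

Let transport_ax (z : fibE) : src (val z).1 = gb_proj (F0 (val z).2 : P).
Proof. by rewrite (sub_ax z) -(bm_proj0 mF). Qed.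

Let transport (z : fibE) : fibP :=
  sub_mk (x := ((val z).1, F0 (val z).2)) (transport_ax z).

Let lift (z : fibE) : @dec_mor R K X P := (transport z, gone (cmH K)).

Definition decorated_connection (z : fibE) : mor E := F1' (lift z).

Let dcC := decorated_connection.

Let dcC_src z : src (dcC z) = (val z).2.
Proof. by rewrite (gm_src (bm_morphism mF')) -[RHS]F0K. Qed.

Let dcC_proj z : b2_proj1 (dcC z) = (val z).1.
Proof. exact: bm_proj1 mF' _. Qed.

Let dcC_smooth : smooth dcC.
Proof.
have pb := gb_principal (gb_ax P).
have aP := manifold_atlased (pb_total pb).
have aF := dec_mor_atlased P.
apply: (smooth_comp aF.1 _ (gm_smooth1 (bm_morphism mF'))).
apply: smooth_pair; last exact: smooth_cst.
apply: smooth_fib_pair; [by case: aX1|by case: aP|exact: smooth_fib_fst|].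
apply: (smooth_comp aE0.1 _ (gm_smooth0 (bm_morphism mF))).
exact: smooth_fib_snd.
Qed.

Lemma decorated_connectionP : is_categorical_connection decorated_connection.
Proof.
split=> //.
- apply: (left_inverse_embedding dcC_smooth fib_rho_smooth) => z.
  apply: val_inj; rewrite /= [RHS]surjective_pairing.
  by congr (_, _); [exact: dcC_proj|exact: dcC_src].
- move=> c2 c1 p2 p1 c e z2 z1 z cE z1E z2E p2E zE eE.
  have tz1 : F0 p2 = dec_tgt (lift z1).
    by rewrite p2E (gm_tgt (bm_morphism mF')) F0'K.
  have ws : dec_src (lift z2) = dec_tgt (lift z1).
    by rewrite -tz1 /dec_src /= z2E.
  pose w : composable D := sub_mk (x := (lift z2, lift z1)) ws.
  rewrite -[RHS](gm_compose (bm_morphism mF') (z := w)) ?eE//.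
  congr F1'; apply: f_equal2; last by apply: val_inj; exact: (esym (lgr_1mul hG1 _)).
  apply: val_inj; rewrite /= zE z1E /=; congr (_, _).
  by congr compose; apply: val_inj; rewrite /= cE z2E z1E.
- move=> z p zE; rewrite /decorated_connection.
  have := gm_idm (bm_morphism mF') (F0 p); rewrite F0K => <-.
  congr F1'; congr (_, _); apply: val_inj; rewrite /= zE; congr (idm _, _).
  by rewrite -(bm_proj0 mF).
- move=> c p g z z' zE z'E.
  (* The pair (1, g) corresponds to 1_g under [cm_iso1], so the law is equivariance of [F1'] under
     it. What remains is that alpha_{g^-1} fixes the unit of H, which keeps the decoration
     trivial. *)
  have := bm_equiv1 mF' (lift z) (gone (cmH K), g).
  rewrite /= /cm_iso1 /= (lgr_1mul hG1) => <-.
  congr F1'; apply: f_equal2; apply: val_inj; rewrite /= ?zE ?z'E /=.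
    by rewrite (bm_equiv0 mF p g).
  by rewrite (ginv1 hG1) !(lgr_mul1 hG1) -(tg_idm_hom hG) (lgr_mulV hG0) tg_idm1.
Qed.

End FromDecorated.

(** * The isomorphism with a decorated bundle built from a connection *)

Section FromConnection.
Variable C : fibE -> mor E.
Hypothesis hC : is_categorical_connection C.

Let C_smooth : smooth C := let: And3 iC _ _ := cc_embedding hC in iC.1.

Definition connection_gbundle_data : gbundle_data (tg0 G) X :=
  @GBundleData R (tg0 G) X (obj E) (@b2_proj0 R G X E) (@b2_act0 R G X E)
    (fun z => tgt (C z)).

Let connection_composable c2 c1 p (z1 z2 : fibE) :
  val z1 = (c1, p) -> val z2 = (c2, tgt (C z1)) -> src (C z2) = tgt (C z1).
Proof. by move=> _ z2E; rewrite (cc_src hC) z2E. Qed.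

Lemma connection_gbundleP : is_gbundle connection_gbundle_data.
Proof.
split.
- exact: b2_principal0 hE.
- exact: smooth_comp aE1.1 C_smooth (gd_tgt_sub hEE).1.
- by move=> z p zE; rewrite /= (cc_idm hC zE) (gd_tgt_idm hEE).
- move=> z; rewrite /= -(gm_tgt (b2_proj_morphism hE)); congr tgt.
  exact: (cc_proj hC).
- move=> c2 c1 p c z1 z2 z cE z1E z2E zE /=.
  pose e : composable E := sub_mk (x := (C z2, C z1)) (connection_composable z1E z2E).
  by rewrite (cc_compose hC cE z1E z2E erefl zE (e := e) erefl) (gd_tgt_compose hEE).
- move=> c p g z z' zE z'E /=.
  by rewrite (cc_act hC zE z'E) act_tgt tg_tgt_idm.
Qed.

Definition connection_gbundle : gbundle (tg0 G) X := GBundle connection_gbundleP.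

Let D := @decorated R K X connection_gbundle.
Let E' := restrict_2group (@cm_iso0 R G) (@cm_iso1 R G) E.

Let deviation_ex (e : mor E) : exists h : tg1 G, b2_act1 e h = C (fib_rho e).
Proof.
by apply: (principal_transitive (b2_principal1 hE)); rewrite (cc_proj hC).
Qed.

(** Chosen point by point; freeness of the action makes the choice unique, and its smoothness is
    recovered by [principal_division_smooth]. *)
Let deviation (e : mor E) : tg1 G := sval (cid (deviation_ex e)).

Let deviationP e : b2_act1 e (deviation e) = C (fib_rho e).
Proof. exact: svalP (cid (deviation_ex e)). Qed.

Let deviation_ker e : ker_set (deviation e).
Proof.
apply: (principal_free (b2_principal0 hE) (p := src e)).
by rewrite -act_src deviationP (cc_src hC) (pb_act1 (b2_principal0 hE)).
Qed.

Let to_dec (e : mor E) : @dec_mor R K X connection_gbundle :=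
  (fib_rho e, sub_mk (deviation_ker e) : cmH K).

Let from_dec (d : @dec_mor R K X connection_gbundle) : mor E :=
  b2_act1 (C d.1) (ginv (val (d.2 : ker_group G))).

(* Freeness of the action of G_1 makes [to_dec e] the only such [d], so the
   laws of a morphism reduce to identities between values of [C]. *)
Let to_decE (e : mor E) (d : @dec_mor R K X connection_gbundle) :
  b2_act1 e (val (d.2 : ker_group G)) = C d.1 -> to_dec e = d.
Proof.
case: d => z h /= ez.
have ze : fib_rho e = z.
  apply: val_inj; rewrite /= [RHS]surjective_pairing -(cc_proj hC) -(cc_src hC) -ez.
  rewrite (pb_act_proj (b2_principal1 hE)) act_src (sub_ax h).
  by rewrite (pb_act1 (b2_principal0 hE)).
rewrite /to_dec; congr (_, _) => //; apply: val_inj.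
apply: (principal_free (b2_principal1 hE) (p := e)).
by rewrite /= deviationP ze.
Qed.

Let to_decK : cancel to_dec from_dec.
Proof.
move=> e; rewrite /from_dec /= -deviationP (pb_actM (b2_principal1 hE)).
by rewrite (lgr_mulV hG1) (pb_act1 (b2_principal1 hE)).
Qed.

Let from_decK : cancel from_dec to_dec.
Proof.
move=> d; apply: to_decE; rewrite /from_dec (pb_actM (b2_principal1 hE)).
by rewrite (lgr_Vmul hG1) (pb_act1 (b2_principal1 hE)).
Qed.

Let to_dec_smooth : smooth to_dec.
Proof.
have aF := gbundle_fib_atlased connection_gbundle.
apply: smooth_pair; first exact: fib_rho_smooth.
apply: smooth_on_sub_val aG1.1 openT _.
apply: (principal_division_smooth (b2_principal1 hE) (f1 := id) aE1.2 _ deviationP).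
exact: smooth_comp aF.1 fib_rho_smooth C_smooth.
Qed.

Let from_dec_smooth : smooth from_dec.
Proof.
have aF := gbundle_fib_atlased connection_gbundle.
have aEG := prod_atlased aE1 aG1.
have sC : @smooth R (@dec_mor R K X connection_gbundle) (mor E) (fun d => C d.1).
  exact: smooth_comp aF.1 (smooth_fst _ aF) C_smooth.
have sk : @smooth R (@dec_mor R K X connection_gbundle) (tg1 G)
    (fun d => val (d.2 : ker_group G)).
  exact: smooth_comp ker_group_atlased.1 (smooth_snd _ ker_group_atlased) (@smooth_val _ _ _ _).
have sV := smooth_comp aG1.1 sk (lgr_inv_smooth hG1).
exact: smooth_comp aEG.1 (smooth_pair sC sV) (gm_smooth1 (b2_act_morphism hE)).
Qed.

(** By [to_decE] it suffices that (e_2 o e_1)(h_2 h_1) = C(gamma_2 o gamma_1, s e_1). The right side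
    factors through C at t(e_1) t(h_1) instead of s(e_2) = t(e_1). Equivariance of C moves the base
    point by the unit of t(h_1), and [act_compose] reassembles the two factors. *)
Let to_dec_compose (z : composable E) (w : composable D) :
  val w = (to_dec (val z).1, to_dec (val z).2) -> to_dec (compose z) = compose w.
Proof.
set e2 := (val z).1; set e1 := (val z).2 => wE; apply: to_decE.
set h2 := deviation e2; set h1 := deviation e1.
have zc : src e2 = tgt e1 := sub_ax z.
have h2s : tg_src h2 = gone (tg0 G) := deviation_ker e2.
have h1s : tg_src h1 = gone (tg0 G) := deviation_ker e1.
(* C(gamma_2, t(e_1) t(h_1)) = e_2 k_2, and k_2 o h_1 = h_2 h_1 in G_1. *)
pose k2 := gmul h2 (tg_idm (tg_tgt h1)).
have k2s : tg_src k2 = tg_tgt h1.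
  by rewrite (tg_src_hom hG) h2s (lgr_1mul hG0) tg_src_idm.
pose k : composable (tg_groupoid G) := sub_mk (x := (k2, h1)) k2s.
have kE : tg_compose k = gmul h2 h1.
  have h2i : tg_src h2 = tg_tgt (tg_idm (gone (tg0 G))) by rewrite h2s tg_tgt_idm.
  have ih1 : tg_src (tg_idm (tg_tgt h1)) = tg_tgt h1 by rewrite tg_src_idm.
  (* Interchange in the 2-group: (h_2 1_{t(h_1)}) o (1 h_1) = (h_2 o 1)(1_{t(h_1)} o h_1) = h_2 h_1,
     where h_2 o 1 is defined because h_2 has source 1. *)
  pose l : composable (tg_groupoid G) := sub_mk (x := (h2, tg_idm (gone (tg0 G)))) h2i.
  pose r : composable (tg_groupoid G) := sub_mk (x := (tg_idm (tg_tgt h1), h1)) ih1.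
  have kM : val k = (gmul (val l).1 (val r).1, gmul (val l).2 (val r).2).
    by rewrite /= tg_idm1 (lgr_1mul hG1).
  have lE : val l = (h2, @idm _ (tg_groupoid G) (@src _ (tg_groupoid G) h2)).
    by rewrite /= h2s.
  rewrite (tg_compose_hom hG kM); congr gmul.
    exact: (gd_idr hGG lE).
  exact: (gd_idl hGG (z := r) (f := h1) erefl).
have t1 : tgt (C (fib_rho e1)) = b2_act0 (src e2) (tg_tgt h1).
  by rewrite -deviationP act_tgt zc.
have s2 : src (b2_proj1 e2) = b2_proj0 (tgt (C (fib_rho e1))).
  by rewrite t1 (pb_act_proj (b2_principal0 hE)) fib_rho_ax.
pose z2 : fibE := sub_mk (x := (b2_proj1 e2, tgt (C (fib_rho e1)))) s2.
have Cz2 : C z2 = b2_act1 e2 k2.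
  rewrite -(pb_actM (b2_principal1 hE)) deviationP.
  by apply: (cc_act hC (z := fib_rho e2) (z' := z2) erefl); rewrite /= t1.
have Cz21 : src (C z2) = tgt (C (fib_rho e1)) by rewrite (cc_src hC).
pose u : composable E := sub_mk (x := (C z2, C (fib_rho e1))) Cz21.
have pc : src (b2_proj1 e2) = tgt (b2_proj1 e1).
  by rewrite fib_rho_ax zc (gm_tgt (b2_proj_morphism hE)).
pose c : composable X := sub_mk (x := (b2_proj1 e2, b2_proj1 e1)) pc.
have uE : val u = (b2_act1 (val z).1 (val k).1, b2_act1 (val z).2 (val k).2).
  by rewrite /= Cz2 deviationP.
transitivity (compose u).
  rewrite -(act_compose uE) kE; congr b2_act1.
  by rewrite /= wE.
apply/esym; apply: (cc_compose hC (c := c) (e := u) (z2 := z2) (z1 := fib_rho e1)) => //.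
rewrite /= wE /=; congr (_, _); congr compose; apply: val_inj.
by rewrite /= wE.
Qed.

Lemma to_dec_morphism : @is_bundle2_morphism R (cm_two_group K) X E' D id to_dec.
Proof.
split; first split.
- exact: aE0.2.
- exact: to_dec_smooth.
- by [].
- move=> e; rewrite /= /dec_tgt /=.
  (* The decorated target is t(e h) t(h^-1), and the two factors t(h), t(h^-1) cancel. *)
  rewrite -deviationP act_tgt (pb_actM (b2_principal0 hE)) -(tg_tgt_hom hG).
  rewrite (lgr_mulV hG1).
  have -> : tg_tgt (gone (tg1 G)) = gone (tg0 G) by exact: hom1 hG1 hG0 (tg_tgt_hom hG).
  exact: pb_act1 (b2_principal0 hE) _.
- move=> p; apply: to_decE; rewrite /= (pb_act1 (b2_principal1 hE)).
  by rewrite (cc_idm hC (p := p)).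
- exact: to_dec_compose.
- by [].
- move=> e a; apply: to_decE => /=.
  (* Acting by (b, g) replaces [e] by e b 1_g and [h] by 1_{g^-1} b^-1 h 1_g. Their product
     telescopes to e h 1_g, which is C of the translated point by equivariance. *)
  set h := deviation e; set g : tg0 G := a.2; set b : tg1 G := val a.1.
  set z' := sub_mk _.
  have -> : C z' = b2_act1 (C (fib_rho e)) (tg_idm g).
    exact: (cc_act hC (z := fib_rho e) (z' := z') erefl).
  rewrite -deviationP !(pb_actM (b2_principal1 hE)); congr b2_act1.
  rewrite /cm_iso1 -/b -/g -/h (homV _ hG0 hG1 (tg_idm_hom hG)).
  rewrite (homV _ hG0 hG1 (tg_idm_hom hG)).
  rewrite (homV _ hG0 hG1 (tg_idm_hom hG)) (ginvK hG1) !(lgr_mulA hG1).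
  rewrite -[gmul (gmul b _) _](lgr_mulA hG1) (lgr_mulV hG1) (lgr_mul1 hG1).
  by rewrite (lgr_mulV hG1) (lgr_1mul hG1).
- by [].
- by [].
Qed.

Lemma from_dec_morphism : @is_bundle2_morphism R (cm_two_group K) X D E' id from_dec.
Proof.
apply: (inverse_bundle2_morphism to_dec_morphism) => //; exact: aE0.2.
Qed.

Lemma connection_is_decorated : is_decorated E.
Proof.
exists connection_gbundle, id, to_dec, id, from_dec; split=> //.
- exact: to_dec_morphism.
- exact: from_dec_morphism.
Qed.

End FromConnection.

End Connections.

Theorem proposition3p17 (R : realType) (G : lie_2group R) (X : lie_groupoid R)
    (E : principal_2bundle G X) :
  is_decorated E <->
  exists C : fibprod (@src R X) (@b2_proj0 R G X E) -> mor E,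
    is_categorical_connection C.
Proof.
split=> [[P [F0 [F1 [F0' [F1' [mF mF' [F0K F0'K] _]]]]]]|[C hC]].
- by eexists; exact: decorated_connectionP mF mF' F0K F0'K.
- exact: connection_is_decorated hC.
Qed.
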